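(* Let $f:X\to Y$ be a closed irreducible continuous map of a metrizable space $X$ onto a Lašnev space $Y$. (1) $Y$ is first-countable at a point $y\in Y$ if and only if $f^{-1}(y)$ is compact. (2) $Y$ is first-countable if and only if $Y$ is metrizable if and only if $f^{-1}(y)$ is compact for every $y\in Y$. (3) $Y$ carries the inductive topology at a point $y\in Y$ with respect to a countable cover of $Y$ by subspaces which are first-countable at $y$ if and only if $f^{-1}(y)$ is locally compact and $\sigma$-compact; the same equivalence holds with ''closed subspaces'' in place of ''subspaces''. (4) $Y$ carries the inductive topology with respect to a countable cover by first-countable closed subspaces if and only if $X=\bigcup_{n\in\omega}X_n^\circ$ for an increasing sequence $(X_n)_{n\in\omega}$ of closed subsets of $X$ such that $X_n\cap f^{-1}(y)$ is compact for every $n\in\omega$ and $y\in Y$; the same equivalence holds with ''metrizable closed subspaces'' in place of ''first-countable closed subspaces''. (5) $Y$ has a neighborhood $\omega^\omega$-base at a point $y\in Y$ if and only if $f^{-1}(y)$ is $\sigma$-compact. (6) $Y$ is universally $\omega^\omega$-based if and only if $X$ is $\sigma'$-compact; and these equivalent conditions imply that $Y$ is $\sigma'$-compact.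
   Context: A Lašnev space is a regular $T_0$-space that is the image of a metrizable space under a closed continuous map. A map $f:X\to Y$ is irreducible if $f[X]=Y$ but $f[Z]\ne Y$ for every closed subset $Z\ne X$ of $X$. $X_n^\circ$ denotes the interior of $X_n$ in $X$. $Y$ carries the inductive topology at $y$ with respect to a family $\mathcal C$ of subspaces if a set $U\subset Y$ containing $y$ is a neighborhood of $y$ in $Y$ if and only if for every $C\in\mathcal C$ with $y\in C$ the set $C\cap U$ is a neighborhood of $y$ in $C$. (In (3), first-countability at $y$ is required of those members of the cover that contain $y$.) $Y$ carries the inductive topology with respect to a cover $\mathcal C$ if this holds at every $y\in Y$ (equivalently, $U\subset Y$ is open iff $U\cap C$ is open in $C$ for all $C\in\mathcal C$). $Y$ has a neighborhood $\omega^\omega$-base at $y$ if there is a neighborhood base $(V_\alpha)_{\alpha\in\omega^\omega}$ at $y$ with $V_\beta\subset V_\alpha$ for all $\alpha\le\beta$ (coordinatewise order on $\omega^\omega$). $Y$ is universally $\omega^\omega$-based if its universal uniformity (the uniformity with base $\{(x,y):d(x,y)<1\}$, $d$ running over all continuous pseudometrics on $Y$) has a base $(U_\alpha)_{\alpha\in\omega^\omega}$ with $U_\beta\subset U_\alpha$ for all $\alpha\le\beta$. A space is $\sigma'$-compact if the set of its non-isolated points is $\sigma$-compact. *)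

(* Defs.v *)
From HB Require Import structures.
From mathcomp Require Import all_boot all_order all_algebra.
From mathcomp Require Import all_classical all_reals all_analysis.
Import Order.TTheory GRing.Theory Num.Theory.
Import numFieldNormedType.Exports.

Set Implicit Arguments.
Unset Strict Implicit.
Unset Printing Implicit Defensive.

Local Open Scope classical_set_scope.
Local Open Scope ring_scope.

(* Throughout, a subspace [A] of [T] is the type [set_type A] (to which [A]
   coerces) with the topology initial for the inclusion [set_val] into [T];
   [set_val @^-1` U] is then the trace of [U] on [A]. *)

Section Pseudometrics.
Context {R : realType}.

Definition pseudometric (T : Type) (d : T -> T -> R) :=
  [/\ forall x y, 0 <= d x y,
      forall x, d x x = 0,
      forall x y, d x y = d y x &
      forall x y z, d x z <= d x y + d y z].

Definition metric (T : Type) (d : T -> T -> R) :=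
  pseudometric d /\ forall x y, d x y = 0 -> x = y.

Definition continuous_pseudometric (T : topologicalType) (d : T -> T -> R) :=
  pseudometric d /\ continuous (fun xy : T * T => d xy.1 xy.2).

End Pseudometrics.

Definition metrizable (R : realType) (T : topologicalType) :=
  exists2 d : T -> T -> R, metric d &
    forall x : T, nbhs x = filter_from [set e : R | 0 < e]
                                       (fun e => [set y | d x y < e]).

Lemma metricType_metrizable (R : realType) (T : metricType R) : metrizable R T.
Proof.
exists (@mdist R T).
  split; last exact: mdist_positivity.
  split; [exact: mdist_ge0|exact: mdistxx|exact: metric_sym|].
  by move=> x y z; exact: metric_triangle.
move=> x; rewrite -nbhs_ballE /nbhs_ball /nbhs_ball_.
by congr filter_from; apply/funext => e; rewrite ballEmdist.
Qed.

Section Maps.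
Context {X Y : topologicalType}.

Definition closed_map (f : X -> Y) :=
  forall A : set X, closed A -> closed (f @` A).

Definition irreducible_map (f : X -> Y) :=
  f @` [set: X] = [set: Y] /\
  forall Z : set X, closed Z -> Z <> [set: X] -> f @` Z <> [set: Y].

End Maps.

Definition lasnev (R : realType) (Y : topologicalType) :=
  [/\ @regular_space Y, @kolmogorov_space Y &
      exists (M : topologicalType) (g : M -> Y),
        [/\ metrizable R M, continuous g, closed_map g &
            g @` [set: M] = [set: Y]]].

Section FirstCountable.
Context {T : topologicalType}.

Definition first_countable_at (x : T) :=
  exists2 B : set (set T), countable B &
    B `<=` nbhs x /\ forall U, nbhs x U -> exists2 V, B V & V `<=` U.

End FirstCountable.

Definition first_countable (T : topologicalType) :=
  forall x : T, first_countable_at x.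

Section Compactness.
Context {T : topologicalType}.

Definition sigma_compact (A : set T) :=
  exists2 K : nat -> set T, (forall n, compact (K n)) & A = \bigcup_n K n.

(* The library's [locally_compact A] asks for compact neighborhoods taken in the
   ambient space, which for a non-closed [A] is weaker than local compactness of
   the subspace [A]; hence the passage to the subspace. *)
Definition locally_compact_subspace (A : set T) := locally_compact [set: A].

End Compactness.

Definition sigma'_compact (T : topologicalType) :=
  sigma_compact (~` isolated [set: T]).

Section InductiveTopology.
Context {Y : topologicalType}.

Definition countable_cover (CC : set (set Y)) :=
  countable CC /\ \bigcup_(C in CC) C = [set: Y].

Definition inductive_at (CC : set (set Y)) (y : Y) :=
  forall U : set Y, U y ->
    (nbhs y U <->
     forall C, CC C -> forall c : C, set_val c = y ->
       nbhs c (set_val @^-1` U : set C)).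

Definition inductive_topology (CC : set (set Y)) :=
  forall y, inductive_at CC y.

Definition first_countable_subspace_at (C : set Y) (y : Y) :=
  forall c : C, set_val c = y -> first_countable_at c.

End InductiveTopology.

(* [F] has a base indexed monotonically by omega^omega. *)
Definition omega_omega_base (T : Type) (F : set_system T) :=
  exists V : (nat -> nat) -> set T,
    [/\ forall a, F (V a),
        forall U, F U -> exists a, V a `<=` U &
        forall a b, (forall n, (a n <= b n)%N) -> V b `<=` V a].

Definition universal_uniformity (R : realType) (Y : topologicalType) :
    set_system (Y * Y) :=
  filter_from (@continuous_pseudometric R Y)
    (fun d => [set xy | d xy.1 xy.2 < 1]).

Definition universally_omega_omega_based (R : realType) (Y : topologicalType) :=
  omega_omega_base (@universal_uniformity R Y).

(* Main.v *)
Require Import Defs.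
From HB Require Import structures.
From mathcomp Require Import all_boot all_order all_algebra.
From mathcomp Require Import all_classical all_reals all_analysis.
From mathcomp Require Import lra.
From mathcomp Require wochoice.
Import Order.TTheory GRing.Theory Num.Theory.
Import numFieldNormedType.Exports.

(** Fix a metric on X and write F_y for the fibre of f over y.  Since f is
    closed, V is a neighborhood of y exactly when the preimage of V is a
    neighborhood of every point of F_y (nbhs_fiberP), so local properties of Y
    at y are properties of the neighborhoods of F_y in X.  Since f is
    irreducible, every nonempty open set contains a whole fibre; hence F_y is
    either an isolated point of X or has empty interior (fiber_dichotomy).

    All the necessity proofs exploit the second case in the same way.  If F_y
    were too large there would be a sequence, or a locally finite family, of
    points of F_y without cluster points; moving each point slightly off F_y,
    into a prescribed neighborhood of F_y, gives a closed set Z disjoint from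
    F_y, and the complement of f(Z) is a neighborhood of y that the given base
    or cover cannot see.  For (1) this makes F_y compact, and for (3) and (4),
    relative to a subspace C, it makes compact the part of F_y that is
    approached from f^-1(C) outside F_y (compact_fiber_frontier).  If the
    topology is inductive at y, finitely many of these parts contain a
    neighborhood in F_y of any given point: otherwise some sequence converging
    to that point has an image that meets each member of the cover containing y
    in a finite set (inductive_at_capture).

    Two further ingredients are needed.

    The metrizability in (2) and (4), and the description of the universal
    uniformity in (6) as the family of all neighborhoods of the diagonal, rest
    on the paracompactness of closed images of metric spaces, in this form:
    for any assignment of neighborhoods to the points of Y there is a
    continuous pseudometric such that two points at distance less than 1 lie in
    a common neighborhood of the family (subordinate_pseudometric).  Michael's
    argument pushes cushioned covers of X forward to Y, which yields a
    countable union of disjoint open families refining a given cover; hedgehog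
    pseudometrics built from Urysohn functions turn it into one pseudometric.

    The sigma-compactness in (5) and (6) comes from a game
    (sigma_compact_of_tests).  Given a base (V_a) indexed by omega^omega, let
    V_s be the intersection of the V_a over all a extending the finite
    sequence s.  For every a, each point x of the set H to be shown
    sigma-compact is captured by V_s for some finite prefix s of a: the
    preimage of V_s is a neighborhood of x for (5), of (x, x) for (6), because
    otherwise countably many bad choices would have a common upper bound in
    omega^omega (prefix_core_avoid).  One player presents sequences of finite families of
    closed balls that eventually cover each point of H; the other answers with
    a natural number k, claiming the k-th family and lengthening s by k, and
    loses as soon as some point captured by V_s lies outside the union of the
    families claimed so far.  A win of the first player assembles, by
    induction on the well-founded tree of plays, a locally finite family of
    points off F_y for (5), of pairs with distinct images for (6), with a
    member in every V_a, which is impossible.  So the second player never has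
    to leave the positions that are not lost.  There are countably many such
    positions, the points that no non-losing answer misses form a relatively
    compact set for each of them, and these sets cover H: a point left out at
    every position would be missed along a play producing a sequence a none of
    whose prefixes captures it. *)

Set Implicit Arguments.
Unset Strict Implicit.
Unset Printing Implicit Defensive.

Local Open Scope classical_set_scope.
Local Open Scope ring_scope.

(** * Metric spaces *)

Section Radius.
Context {R : realType}.

Definition dyadic (n : nat) : R := 2^-1 ^+ n.

Lemma dyadic_gt0 n : 0 < dyadic n.
Proof. by rewrite exprn_gt0// invr_gt0. Qed.

Lemma dyadicS n : dyadic n.+1 + dyadic n.+1 = dyadic n.
Proof. by rewrite /dyadic exprS; lra. Qed.

Lemma le_dyadic m n : (m <= n)%N -> dyadic n <= dyadic m.
Proof.
by move=> mn; apply: ler_wiXn2l => //; rewrite ?invr_ge0// invf_le1 ?ler1n.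
Qed.

Lemma dyadic_lt (e : R) : 0 < e -> exists n, dyadic n < e.
Proof.
move=> e0; have [n ne] : exists n : nat, e^-1 < n%:R.
  by exists (Num.bound e^-1); apply: archi_boundP; rewrite invr_ge0 ltW.
exists n; rewrite /dyadic exprVn invf_plt ?posrE ?exprn_gt0//.
by apply: (lt_trans ne); rewrite -natrX ltr_nat ltn_expl.
Qed.

End Radius.

(** Sequences without cluster point: in a metric space, the witnesses of
    non-compactness. *)
Definition escaping {T : topologicalType} (x : nat -> T) :=
  forall p : T, exists2 U, nbhs p U &
    exists N, forall n, (N <= n)%N -> ~ U (x n).

Section Metric.
Context {R : realType} {X : topologicalType}.

Definition dball (d : X -> X -> R) (x : X) (e : R) := [set y | d x y < e].

Definition metrizes (d : X -> X -> R) :=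
  metric d /\
  forall x : X, nbhs x = filter_from [set e : R | 0 < e] (dball d x).

Variable d : X -> X -> R.
Hypothesis dX : metrizes d.

Lemma dist_ge0 x y : 0 <= d x y. Proof. by case: dX => -[[]]. Qed.
Lemma distxx x : d x x = 0. Proof. by case: dX => -[[]]. Qed.
Lemma distC x y : d x y = d y x. Proof. by case: dX => -[[]]. Qed.
Lemma dist_triangle x y z : d x z <= d x y + d y z.
Proof. by case: dX => -[[]]. Qed.
Lemma dist_eq0 x y : d x y = 0 -> x = y. Proof. by case: dX => -[_ +] _; exact. Qed.

Lemma nbhs_dball x e : 0 < e -> nbhs x (dball d x e).
Proof. by move=> e0; rewrite (proj2 dX); exists e. Qed.

Lemma nbhs_dballP x U : nbhs x U -> exists n, dball d x (dyadic n) `<=` U.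
Proof.
rewrite (proj2 dX) => -[e /= e0 xeU]; have [n ne] := dyadic_lt e0.
by exists n => y /lt_trans-/(_ _ ne); exact: xeU.
Qed.

Lemma dball_center x e : 0 < e -> dball d x e x.
Proof. by rewrite /dball/= distxx. Qed.

Lemma dball_subset x y e e' : d y x + e <= e' -> dball d x e `<=` dball d y e'.
Proof.
move=> le z xz; apply: le_lt_trans (dist_triangle y x z) _.
by apply: lt_le_trans le; rewrite ltrD2l.
Qed.

Lemma open_dball x e : open (dball d x e).
Proof.
rewrite openE => y xy; rewrite /interior (proj2 dX); exists (e - d x y) => /=.
  by rewrite subr_gt0.
by apply: dball_subset; rewrite subrKC.
Qed.

Lemma metrizes_accessible : accessible_space X.
Proof.
move=> x y xy; exists (dball d x (d x y)); split.
- exact: open_dball.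
- rewrite inE /dball/= distxx lt_neqAle dist_ge0 andbT.
  by apply: contra_neq xy => /esym /dist_eq0.
- by rewrite inE /dball/= ltxx.
Qed.

(** Two sequences at vanishing distance have the same cluster points. *)
Lemma escaping_perturb (x z : nat -> X) :
  escaping x -> (forall n, d (x n) (z n) < dyadic n) -> escaping z.
Proof.
move=> ex xz p; have [U pU [N NU]] := ex p.
have [m mU] := nbhs_dballP pU.
exists (dball d p (dyadic m.+1)); first exact/nbhs_dball/dyadic_gt0.
exists (maxn N m.+1) => n; rewrite geq_max => /andP[Nn mn] pz.
apply: (NU n Nn); apply: mU; rewrite /dball/= -dyadicS.
apply: le_lt_trans (dist_triangle p (z n) _) _.
by rewrite ltrD// distC (lt_le_trans (xz n))// le_dyadic.
Qed.

Lemma escaping_closed (z : nat -> X) (S : set nat) :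
  escaping z -> closed (z @` S).
Proof.
move=> ez p clp; have [U pU [N NU]] := ez p.
have : closure (z @` (S `&` `I_N)) p.
  move=> V pV; have [|q [[n Sn <-] [Vn Un]]] := clp (V `&` U).
    exact: filterI.
  exists (z n); split => //; exists n => //; split => //=.
  by rewrite ltnNge; apply/negP => /NU.
move/closure_id: (accessible_finite_set_closed.1 metrizes_accessible
  (z @` (S `&` `I_N)) (finite_image _ (finite_setIr _ (finite_II _)))) => <-.
by case=> n [Sn _] <-; exists n.
Qed.

Lemma not_escapingP (x : nat -> X) : ~ escaping x ->
  exists p, forall n N, exists2 m, (N <= m)%N & d p (x m) < dyadic n.
Proof.
move=> /existsNP[p px]; exists p => n N; apply: contrapT => xN; apply: px.
exists (dball d p (dyadic n)); first exact/nbhs_dball/dyadic_gt0.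
by exists N => m Nm pm; apply: xN; exists m.
Qed.

(** A Lebesgue number.  The property P may be inclusion in a fixed open set,
    or an oscillation bound for a pseudometric. *)
Lemma compact_lebesgue (K : set X) (P : set X -> Prop) :
  compact K -> (forall U V, U `<=` V -> P V -> P U) ->
  (forall x, K x -> exists2 U, nbhs x U & P U) ->
  exists n, forall x, K x -> P (dball d x (dyadic n)).
Proof.
move=> /compact_near_coveringP cK Pmono locP.
have [|n _ Kn] := cK _ (\oo) (fun n x => P (dball d x (dyadic n))) _.
- move=> x /locP[U xU PU]; have [m mU] := nbhs_dballP xU.
  exists (dball d x (dyadic m.+1), [set n | (m.+1 <= n)%N]).
    by split; [exact/nbhs_dball/dyadic_gt0 | exists m.+1].
  move=> [y n]/= [xy mn]; apply: Pmono PU; apply: subset_trans mU.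
  by apply: dball_subset; rewrite -(dyadicS m) lerD ?(ltW xy)// le_dyadic.
- by exists n; exact: Kn n (leqnn n).
Qed.

(** Such a set A is totally bounded, since otherwise greedy choices give an
    escaping separated sequence.  Hence an ultrafilter on the closure of A
    contains balls of every radius, and it converges to any cluster point of a
    sequence of A that follows these balls. *)
Lemma compact_closure_seq (A : set X) :
  (forall x : nat -> X, (forall n, A (x n)) -> ~ escaping x) ->
  compact (closure A).
Proof.
move=> Aseq.
(* A is totally bounded *)
have tb n : exists s : seq X,
    forall a, A a -> exists2 x, x \in s & d x a < dyadic n.
  apply: contrapT => noS.
  have new (s : seq X) : exists x, A x /\ forall y, y \in s -> dyadic n <= d y x.
    apply: contrapT => nox; apply: noS; exists s => a Aa; apply: contrapT => sa.
    apply: nox; exists a; split => // y ys; rewrite leNgt; apply/negP => ya.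
    by apply: sa; exists y.
  have [g gP] := choice new.
  pose L := fix L k := if k is k'.+1 then g (L k') :: L k' else [::].
  have gL k m : (k < m)%N -> g (L k) \in L m.
    elim: m => // m IH; rewrite ltnS leq_eqVlt => /predU1P[->|/IH].
      by rewrite /= mem_head.
    by rewrite /= in_cons => ->; rewrite orbT.
  apply: (Aseq (fun k => g (L k))) => [k|p]; first exact: (gP (L k)).1.
  exists (dball d p (dyadic n.+1)); first exact/nbhs_dball/dyadic_gt0.
  have [[k pk]|nok] := pselect (exists k, dball d p (dyadic n.+1) (g (L k))).
    exists k.+1 => m km pm; have := (gP (L m)).2 _ (gL _ _ km).
    apply/negP; rewrite -ltNge; apply: le_lt_trans (dist_triangle _ p _) _.
    by rewrite -dyadicS ltrD// distC.
  by exists 0%N => m _ pm; apply: nok; exists m.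
rewrite compact_ultra => F FU FA.
have Fsmall n : exists x, F (dball d x (dyadic n)).
  have [s As] := tb n.+1.
  have : F [set y | exists2 x, x \in s & d x y < dyadic n].
    apply: filterS FA => y /(_ _ (nbhs_dball y (dyadic_gt0 n.+1)))[z [Az yz]].
    have [x xs xz] := As _ Az; exists x => //; rewrite -dyadicS.
    by apply: le_lt_trans (dist_triangle _ z _) _; rewrite ltrD// distC.
  elim: s {As} => [|x s IH] Fxs; first by have [y []] := filter_ex Fxs.
  have [Fx|nFx] := in_ultra_setVsetC (dball d x (dyadic n)) FU.
    by exists x.
  apply: IH; apply: filterS (filterI Fxs nFx) => y [[z + zy] nxy].
  by rewrite in_cons => /predU1P[zx|zs]; [rewrite zx in zy | exists z].
have [a aP] := choice Fsmall.
pose E n := \bigcap_(i < n.+1) dball d (a i) (dyadic i).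
have FE n : F (E n).
  elim: n => [|n IH]; first by apply: filterS (aP 0%N) => y ay [|].
  apply: filterS (filterI IH (aP n.+1)) => y [Ey ay] i /=.
  by rewrite ltnS leq_eqVlt => /predU1P[->|/Ey].
have Ane n : exists z, A z /\ exists2 y, E n y & d z y < dyadic n.
  have [y [Ey clAy]] := filter_ex (filterI (FE n) FA).
  have [z [Az yz]] := clAy _ (nbhs_dball y (dyadic_gt0 n)).
  by exists z; split => //; exists y; rewrite // distC.
have [z zP] := choice Ane.
have [p pP] := not_escapingP (Aseq z (fun n => (zP n).1)).
have Fp n : F (dball d p (dyadic n)).
  apply: filterS (aP n.+3) => y ay.
  have [m nm pm] := pP n.+3 n.+3.
  have [y' Ey' zy'] := (zP m).2.
  have := Ey' n.+3; rewrite /= ltnS => /(_ nm) ay'.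
  rewrite /dball/=.
  have := dyadic_gt0 (R := R) n.+3; have := le_dyadic (R := R) nm.
  have := dyadicS (R := R) n; have := dyadicS (R := R) n.+1.
  have := dyadicS (R := R) n.+2.
  have := dist_triangle p (z m) y; have := dist_triangle (z m) y' y.
  have := dist_triangle y' (a n.+3) y; rewrite (distC y' (a n.+3)).
  move: ay ay' pm zy'; rewrite /dball/=; lra.
have Fcvg : F --> p by move=> U /nbhs_dballP[n nU]; apply: filterS nU (Fp n).
exists p; split => //; apply: closed_closure => U /Fcvg FUU.
exact: filter_ex (filterI FA FUU).
Qed.

End Metric.

(** * Countable bases and fibres of closed maps *)

Section Countability.

Lemma countable_sequence (T : Type) (B : set (set T)) : countable B ->
  exists C : nat -> set T,
    (forall D, B D -> exists n, C n = D) /\ forall n, B (C n) \/ C n = set0.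
Proof.
have [->|/set0P B0] := eqVneq B set0.
  by move=> _; exists (fun=> set0); split => // n; right.
move=> /pfcard_geP[B00|[g]]; first by case: B0 => D; rewrite B00.
exists g; split => [D BD|n]; last by left; exact: funS.
by have [n _ <-] := 'surj_g BD; exists n.
Qed.

Lemma filter_forall_le (T : Type) (F : set_system T) (D : nat -> set T) n :
  Filter F -> (forall i, (i <= n)%N -> F (D i)) ->
  F [set y | forall i, (i <= n)%N -> D i y].
Proof.
move=> FF; elim: n => [|n IH] FD.
  by apply: filterS (FD 0%N (leqnn _)) => y Dy i; rewrite leqn0 => /eqP->.
have FDn := FD _ (leqnn n.+1).
apply: filterS (filterI (IH _) FDn) => [y [Dy Dyn] i|i /leqW/FD//].
by rewrite leq_eqVlt => /predU1P[->//|]; rewrite ltnS => /Dy.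
Qed.

Lemma first_countable_seq (T : topologicalType) (x : T) :
  first_countable_at x <->
  exists2 V : nat -> set T, (forall n, nbhs x (V n)) &
    forall U, nbhs x U -> exists n, V n `<=` U.
Proof.
split=> [[B /countable_sequence[C [CB BC]] [Bx xB]]|[V Vx xV]]; last first.
  exists (range V); first exact: (card_le_trans (card_image_le _ _)).
  split=> [_ [n _ <-]//|U /xV[n nU]]; by exists (V n).
exists (fun n => if pselect (B (C n)) then C n else setT) => [n|U].
  by case: pselect => [BCn|nBCn]; [exact: Bx | exact: filterT].
move=> /xB[W BW WU]; have [n nW] := CB _ BW; exists n => y.
by rewrite -nW in BW WU *; case: pselect => [Bn /WU|] //.
Qed.

Lemma nbhs_set_typeP (T : topologicalType) (C : set T) (c : C) (U : set C) :
  nbhs c U <-> exists2 V, nbhs (set_val c) V & set_val @^-1` V `<=` U.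
Proof.
split=> [[_ [[V oV <-] Vc] VU]|[V]].
  by exists V => //; exact: open_nbhs_nbhs.
by move=> cV VU; apply: filterS VU _; exact: initial_continuous.
Qed.

End Countability.

Section ClosedMap.
Context {X Y : topologicalType} (f : X -> Y).
Hypotheses (cf : closed_map f) (ctf : continuous f).

(** The dual image of U: the points whose whole fibre lies in U. *)
Definition small_image (U : set X) := [set y | f @^-1` [set y] `<=` U].

Lemma open_small_image U : open U -> open (small_image U).
Proof.
move=> /open_closedC/cf; rewrite -openC; congr open.
apply/seteqP; split=> y yU.
  by move=> x fx; apply: contrapT => Ux; apply: yU; exists x.
by move=> [x Ux fx]; apply: Ux; exact: yU.
Qed.

Hypothesis sf : f @` setT = setT.

Lemma surj_ex y : exists x, f x = y.
Proof. by have : [set: Y] y by []; rewrite -sf => -[x _ fx]; exists x. Qed.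

Lemma small_imageW U y : small_image U y -> exists2 x, U x & f x = y.
Proof. by have [x fx] := surj_ex y => /(_ x fx); exists x. Qed.

(** The dual image of the interior of the preimage of W is open and lies in
    W. *)
Lemma nbhs_fiberP y W :
  nbhs y W <-> forall x, f x = y -> nbhs x (f @^-1` W).
Proof.
split=> [yW x fx|H]; first by apply: ctf; rewrite fx.
have oU : open (f @^-1` W)° by exact: open_interior.
apply: (@filterS _ _ _ (small_image (f @^-1` W)°)).
  by move=> z /small_imageW[x /interior_subset Wx <-].
by apply: open_nbhs_nbhs; split; [exact: open_small_image | exact: H].
Qed.

Lemma nbhs_small_image y U : (forall x, f x = y -> nbhs x U) ->
  nbhs y (small_image U).
Proof.
move=> H; apply: (@filterS _ _ _ (small_image U°)).
  by move=> z zU x /zU/interior_subset.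
by apply: open_nbhs_nbhs; split; [exact/open_small_image/open_interior | exact: H].
Qed.

Lemma nbhs_image_setC y (A : set X) : closed A -> (forall x, A x -> f x <> y) ->
  nbhs y (~` (f @` A)).
Proof.
move=> /cf/closed_openC oA Ay; apply: open_nbhs_nbhs; split => //.
by move=> [x /Ay].
Qed.

End ClosedMap.

Section Irreducible.
Context {X Y : topologicalType} (f : X -> Y).
Hypotheses (irf : irreducible_map f) (T1X : accessible_space X).

(** Otherwise the complement of U would be a proper closed set with full
    image. *)
Lemma irreducible_fiber U : open U -> U !=set0 ->
  exists y, small_image f U y.
Proof.
move=> oU [x Ux]; have := irf.2 _ (open_closedC oU).
have nT : ~` U <> [set: X] by move=> UT; have : (~` U) x by rewrite UT.
move=> /(_ nT) /eqP/setTPn[y yU]; exists y => z fz.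
by apply: contrapT => Uz; apply: yU; exists z.
Qed.

(** The fibre contained in U can only be the fibre of y. *)
Lemma open_subset_fiber y U : open U -> U !=set0 -> U `<=` f @^-1` [set y] ->
  f @^-1` [set y] `<=` U.
Proof.
move=> oU U0 Uy; have [z zU] := irreducible_fiber oU U0.
have [x fx] := surj_ex irf.1 z; have Ux := zU x fx.
by have -> : y = z by rewrite -fx; apply/esym; exact: Uy.
Qed.

(** The interior of F_y is all of F_y; if F_y had a second point, removing it
    would leave an open subset that does not contain F_y. *)
Lemma fiber_interior y x : (f @^-1` [set y])° x -> f @^-1` [set y] = [set x].
Proof.
move=> Fx; have oF : open (f @^-1` [set y])° by exact: open_interior.
have FF := open_subset_fiber oF (ex_intro _ x Fx) (@interior_subset _ _).
apply/seteqP; split=> [z Fz|_ ->]; last exact: interior_subset.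
apply: contrapT => zx.
have /(_ _ Fz)[_] : f @^-1` [set y] `<=` (f @^-1` [set y])° `&` ~` [set z].
  apply: open_subset_fiber.
  - by apply: openI => //; apply: closed_openC; exact: accessible_closed_set1.
  - by exists x; split => // xz; apply: zx.
  - by move=> w [/interior_subset].
by apply.
Qed.

(** In the second case F_y can be left from any of its points by arbitrarily
    small moves. *)
Lemma fiber_dichotomy y :
  (exists2 x : X, nbhs x [set x] & f @^-1` [set y] = [set x]) \/
  (forall x N, f x = y -> nbhs x N -> exists2 z, N z & f z <> y).
Proof.
have [[x Fx]|F0] := pselect ((f @^-1` [set y])° !=set0).
  left; exists x; last exact: fiber_interior.
  by rewrite -(fiber_interior Fx).
right=> x N fx xN; apply: contrapT => Nf; apply: F0; exists x.
apply: filterS xN => z Nz /=; apply: contrapT => fz; apply: Nf; by exists z.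
Qed.

End Irreducible.

(** * First countability and compact fibres *)

Section FirstCountability.
Context {R : realType} {X Y : topologicalType} (d : X -> X -> R) (f : X -> Y).
Hypotheses (dX : metrizes d) (cf : closed_map f) (ctf : continuous f).

(** An escaping sequence in this part of the fibre could be moved to points
    z_n of f^-1(C) outside F_y with f(z_n) in V_n.  The image of this closed
    set misses y, but every V_n meets it inside C.  Taking C = Y handles
    first-countable points; general C handles subspaces. *)
Lemma compact_fiber_frontier (C : set Y) (y : Y) (V : nat -> set Y) :
  closed [set y] ->
  (forall n, nbhs y (V n)) ->
  (forall U, nbhs y U -> exists n, V n `&` C `<=` U) ->
  compact (f @^-1` [set y] `&` closure (f @^-1` C `\` f @^-1` [set y])).
Proof.
move=> cy Vy VC; set F := f @^-1` [set y]; set K := F `&` _.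
have cK : closed K.
  apply: closedI; last exact: closed_closure.
  by apply: closed_comp => // x _; exact: ctf.
rewrite (closure_id K).1//; apply: (compact_closure_seq dX) => x Kx ex.
have step n : exists z, [/\ d (x n) z < dyadic n, C (f z), f z <> y & (V n) (f z)].
  have [Fx clx] := Kx n.
  have [|z [[Cz Fz] [xz Vz]]] := clx (dball d (x n) (dyadic n) `&` f @^-1` (V n)).
    apply: filterI; first exact/(nbhs_dball dX)/dyadic_gt0.
    by apply: ctf; rewrite Fx; exact: Vy.
  by exists z.
have [z zP] := choice step.
have ez : escaping z by apply: (escaping_perturb dX ex) => n; have [] := zP n.
have [|n nz] := VC (~` (f @` range z)).
  apply: nbhs_image_setC => //; first exact: (escaping_closed dX).
  by move=> _ [n _ <-]; have [] := zP n.
have [_ Cz _ Vz] := zP n.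
by apply: (nz (f (z n))) => //; exists (z n) => //; exists n.
Qed.

Hypothesis sf : f @` setT = setT.

(** The dual images of the metric neighborhoods of a compact fibre form a
    base. *)
Lemma first_countable_compact_fiber y : compact (f @^-1` [set y]) ->
  first_countable_at y.
Proof.
move=> cF; apply/first_countable_seq.
exists (fun n => small_image f
  (\bigcup_(x in f @^-1` [set y]) dball d x (dyadic n))) => [n|U yU].
- apply: nbhs_small_image => // x fx; apply: filterS (nbhs_dball dX x (dyadic_gt0 n)).
  by move=> z; exists x.
- have [||n nU] := compact_lebesgue dX (P := fun V => V `<=` f @^-1` U) cF.
  + by move=> V W VW /(subset_trans VW).
  + by move=> x Fx; exists (f @^-1` U) => //; apply: ctf; rewrite Fx.
  exists n => z /(small_imageW sf)[x [w Fw wx] <-]; exact: nU wx.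
Qed.

End FirstCountability.

Section FirstCountableFibers.
Context {R : realType} {X Y : topologicalType} (d : X -> X -> R) (f : X -> Y).
Hypotheses (dX : metrizes d) (cf : closed_map f) (ctf : continuous f).
Hypotheses (irf : irreducible_map f) (T1Y : accessible_space Y).

Theorem first_countable_fiberP y :
  first_countable_at y <-> compact (f @^-1` [set y]).
Proof.
split; last exact: (first_countable_compact_fiber dX cf ctf irf.1).
move=> /first_countable_seq[V Vy VU].
have [[x _ ->]|Fy] := fiber_dichotomy irf (metrizes_accessible dX) y.
  exact: compact_set1.
have -> : f @^-1` [set y] =
    f @^-1` [set y] `&` closure (f @^-1` setT `\` f @^-1` [set y]).
  apply/seteqP; split=> [x Fx|x []//]; split => // N xN.
  by have [z Nz fz] := Fy x N Fx xN; exists z.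
apply: (compact_fiber_frontier dX cf ctf _ Vy).
- exact: accessible_closed_set1.
- by move=> U /VU[n nU]; exists n => z [/nU].
Qed.

End FirstCountableFibers.

(** * Cushioned covers and disjoint open refinements *)

(** What the refinement argument needs of a well-order: minima, and
    comparability of distinct elements. *)
Lemma well_ordered_index (I : eqType) : exists lt : I -> I -> Prop,
  (forall A : set I, A !=set0 -> exists2 s, A s & forall t, lt t s -> ~ A t) /\
  (forall s t, s <> t -> lt s t \/ lt t s).
Proof.
have [le wo] := wochoice.well_ordering_principle I.
have min (A : set I) : A !=set0 ->
    exists s, A s /\ (forall t, A t -> le s t) /\
    forall s', A s' -> (forall t, A t -> le s' t) -> s = s'.
  move=> [a Aa]; have [|s [[As sA] us]] := wo [pred x | `[< A x >]].
    by exists a; apply/asboolP.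
  exists s; split; first exact/asboolP.
  split=> [t At|s' As' s'A]; first exact/sA/asboolP.
  apply: us; split=> [|t]; first exact/asboolP.
  by move=> /asboolP/s'A.
exists (fun t s => ~~ le s t); split=> [A /min[s [As [sA _]]]|s t st].
  by exists s => // t nst /sA; apply/negP.
apply: contrapT => /not_orP[/negP + /negP]; rewrite !negbK => lts lst.
have refl a : le a a.
  by have [|b [-> [+ _]]] := min [set a]; [exists a | apply].
have [|m [_ [_ um]]] := min [set s; t]; first by exists s; left.
apply: st; transitivity m; [apply/esym|]; apply: um.
- by left.
- by move=> x [->|->].
- by right.
- by move=> x [->|->].
Qed.

Section Cushion.
Context {R : realType} {X Y : topologicalType} (d : X -> X -> R) (f : X -> Y).
Hypothesis dX : metrizes d.

(** Let m x be the least m such that the ball of radius 2^-m around x lies in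
    some G s.  It changes by at most one between nearby points, so if G s
    contains the ball of radius 2^-(m x + k) around a point x close enough to
    p, then the same G s contains the ball of radius 2^-(m p + k + 2) around
    p. *)
Lemma metric_cushion (I : Type) (G : I -> set X) :
  (forall s, open (G s)) -> (forall x, exists s, G s x) ->
  exists E E' : I -> set X, [/\ forall x, exists s, E s x,
    forall S : set I, closure (\bigcup_(s in S) E s) `<=` \bigcup_(s in S) E' s &
    forall S : set I, closure (\bigcup_(s in S) E' s) `<=` \bigcup_(s in S) G s].
Proof.
move=> oG cG.
have min x : exists m, (exists s, dball d x (dyadic m) `<=` G s) /\
    forall k, (exists s, dball d x (dyadic k) `<=` G s) -> (m <= k)%N.
  have exm : exists m, `[< exists s, dball d x (dyadic m) `<=` G s >].
    have [s Gx] := cG x.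
    have [m mG] := nbhs_dballP dX (open_nbhs_nbhs (conj (oG s) Gx)).
    by exists m; apply/asboolP; exists s.
  case: (ex_minnP exm) => m /asboolP mG mm; exists m; split => // k kG.
  by apply: mm; apply/asboolP.
have [m mP] := choice min.
pose E k s := [set x | dball d x (dyadic (m x + k)%N) `<=` G s].
have cushion k (S : set I) :
    closure (\bigcup_(s in S) E k s) `<=` \bigcup_(s in S) E k.+2 s.
  move=> p clp.
  have [x [[s Ss xs] px]] := clp _ (nbhs_dball dX p (dyadic_gt0 (m p + k.+2)%N)).
  have mxp : (m x <= (m p).+1)%N.
    apply: (mP x).2; have [[t pt] _] := mP p; exists t; apply: subset_trans pt.
    apply: dball_subset => //; rewrite -(dyadicS (m p)) lerD2r.
    apply: ltW; apply: lt_le_trans px _; apply: le_dyadic.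
    by rewrite addnS ltnS addnS leqW ?leq_addr.
  exists s => //; apply: subset_trans xs; apply: dball_subset => //.
  rewrite (distC dX); apply: (@le_trans _ _ (dyadic (m p + k.+1)%N : R)); last first.
    by apply: le_dyadic; rewrite addnS -addSn leq_add2r.
  by rewrite -(dyadicS (m p + k.+1)%N) -addnS lerD// ltW.
exists (E 0%N), (E 2%N); split=> [x|S|S]; try exact: cushion.
- by have [[s xs] _] := mP x; exists s; rewrite /E/= addn0.
- apply: subset_trans (cushion _ _) _ => x [s Ss xs]; exists s => //.
  by apply: xs; apply: (dball_center dX); exact: dyadic_gt0.
Qed.

Hypotheses (cf : closed_map f) (ctf : continuous f) (sf : f @` setT = setT).

(** The closure of the image under a closed map lies in the image of the
    closure, so cushioned covers can be pushed forward. *)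
Lemma image_cushion (I : Type) (U : I -> set Y) :
  (forall s, open (U s)) -> (forall y, exists s, U s y) ->
  exists F F' : I -> set Y, [/\ forall y, exists s, F s y,
    forall S : set I, closure (\bigcup_(s in S) F s) `<=` \bigcup_(s in S) F' s &
    forall S : set I, closure (\bigcup_(s in S) F' s) `<=` \bigcup_(s in S) U s].
Proof.
move=> oU cU.
have [||E [E' [cE EE' E'U]]] := @metric_cushion I (fun s => f @^-1` U s).
- by move=> s; apply: open_comp => // x _; exact: ctf.
- by move=> x; exact: cU.
have push (A B : I -> set X) (S : set I) :
    closure (\bigcup_(s in S) A s) `<=` \bigcup_(s in S) B s ->
    closure (\bigcup_(s in S) (f @` A s)) `<=` \bigcup_(s in S) (f @` B s).
  rewrite -!image_bigcup => AB.
  apply: subset_trans (image_subset f AB).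
  rewrite [X in X `<=` _]closureE; apply: bigcap_inf; split.
    by apply: cf; exact: closed_closure.
  by apply: image_subset; exact: subset_closure.
exists (fun s => f @` E s), (fun s => f @` E' s); split=> [y|S|S].
- have [x <-] := surj_ex sf y; have [s Es] := cE x.
  by exists s; exists x.
- exact: push.
- apply: subset_trans (push _ _ _ (E'U S)) _.
  by apply: subset_bigcup => s Ss _ [x Ux <-].
Qed.

(** Michael's argument.  At stage i + 1 the set U s is diminished by the
    closure of the stage i cushions of the indices below s; what remains still
    covers, because this closure lies in the union of the U t with t below s.
    W i s consists of the points that are away from all stage i pieces except
    that of s.  Given y, let s be the least index for which y lies in a
    cushion at some stage i.  At stage i + 1, y avoids the pieces of smaller
    indices by minimality, and those of larger indices by construction. *)
Lemma sigma_disjoint_open_refinement (I : eqType) (U : I -> set Y) :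
  (forall s, open (U s)) -> (forall y, exists s, U s y) ->
  exists W : nat -> I -> set Y, [/\ forall i s, open (W i s),
    forall i s, W i s `<=` U s,
    forall i s t y, W i s y -> W i t y -> s = t &
    forall y, exists i s, W i s y].
Proof.
move=> oU cU; have [lt [ltmin ltC]] := well_ordered_index I.
have step (V : I -> set Y) : exists FF : (I -> set Y) * (I -> set Y),
    (forall s, open (V s)) /\ (forall y, exists s, V s y) ->
    [/\ forall y, exists s, FF.1 s y,
    forall S : set I, closure (\bigcup_(s in S) FF.1 s) `<=` \bigcup_(s in S) FF.2 s &
    forall S : set I, closure (\bigcup_(s in S) FF.2 s) `<=` \bigcup_(s in S) V s].
  have [[oV cV]|nV] :=
      pselect ((forall s, open (V s)) /\ (forall y, exists s, V s y)).
    by have [F [F' FP]] := image_cushion oV cV; exists (F, F').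
  by exists (V, V) => /nV.
have [Phi PhiP] := choice step.
pose V := fix V i := if i is j.+1 then
  fun s => U s `\` closure (\bigcup_(t in lt ^~ s) (Phi (V j)).2 t) else U.
pose F i := (Phi (V i)).1; pose F' i := (Phi (V i)).2.
have VU i s : V i s `<=` U s by case: i => // i y [].
have VP i : (forall s, open (V i s)) /\ (forall y, exists s, V i s y).
  elim: i => [//|i IH]; split=> [s|y] /=.
    by rewrite setDE; apply: openI => //; exact/closed_openC/closed_closure.
  have [s Us ltU] := ltmin _ (cU y); exists s; split => //.
  have [_ _ F'V] := PhiP _ IH.
  by move=> /F'V[t ts /VU]; exact: ltU.
have cF i y : exists s, F i s y by have [+ _ _] := PhiP _ (VP i); exact.
have FF' i (S : set I) :
    closure (\bigcup_(s in S) F i s) `<=` \bigcup_(s in S) F' i s.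
  by have [_ + _] := PhiP _ (VP i); exact.
have F'V i (S : set I) :
    closure (\bigcup_(s in S) F' i s) `<=` \bigcup_(s in S) V i s.
  by have [_ _] := PhiP _ (VP i); exact.
pose W i s := ~` closure (\bigcup_(t in [set t | t <> s]) F i t).
have WF i s t y : W i s y -> F i t y -> t = s.
  move=> Wy Fy; apply: contrapT => ts; apply: Wy; apply: subset_closure.
  by exists t.
have F'U i s : F' i s `<=` U s.
  move=> y Fy; apply: (VU i).
  by have [|_ -> //] := F'V i [set s] y; apply: subset_closure; exists s.
exists W; split=> [i s|i s y Wy|i s t y Ws Wt|y].
- exact/closed_openC/closed_closure.
- have [t Ft] := cF i y; have ts := WF _ _ _ _ Wy Ft; rewrite ts in Ft.
  apply: (F'U i); have [|_ -> //] := FF' i [set s] y.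
  by apply: subset_closure; exists s.
- have [r Fr] := cF i y.
  by rewrite -(WF _ _ _ _ Ws Fr) (WF _ _ _ _ Wt Fr).
- have [|s [i Fs] mins] := ltmin [set s | exists i, F' i s y].
    have [s Fs] := cF 0%N y; exists s, 0%N.
    by have [|_ -> //] := FF' 0%N [set s] y; apply: subset_closure; exists s.
  exists i.+1, s; rewrite /W => clF.
  have : closure (\bigcup_(t in lt ^~ s) F i.+1 t `|`
                  \bigcup_(t in lt s) F i.+1 t) y.
    apply: closureS clF => z [t /ltC[st|st] Ft]; last by right; exists t.
    by left; exists t.
  rewrite closureU => -[/FF'[t ts Ft]|clF'].
    by apply: (mins t ts); exists i.+1.
  have : closure (\bigcup_(t in lt s) F' i.+1 t) y.
    by apply: subset_closure; exact: FF'.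
  move=> /F'V[t st [_]]; apply; apply: subset_closure; exists s => //.
Qed.

End Cushion.

(** * Pseudometrics on closed images *)

Section Pseudometric.
Context {R : realType} {T : topologicalType}.
Implicit Types rho : T -> T -> R.

(** By the triangle inequality, continuity on the diagonal suffices. *)
Lemma continuous_pseudometricP rho : pseudometric rho ->
  (forall x e, 0 < e -> nbhs x [set y | rho x y < e]) ->
  continuous_pseudometric rho.
Proof.
move=> prho nrho; split=> // -[x y]; case: prho => r0 rxx rC rD.
apply/cvgrPdist_lt => e e0; have e2 : 0 < e / 2 by rewrite divr_gt0.
exists ([set z | rho x z < e / 2], [set z | rho y z < e / 2]).
  by split; exact: nrho.
move=> [x' y']/= [xx' yy'].
have := rD x x' y; have := rD x' y' y; have := rD x' x y'; have := rD x y y'.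
rewrite (rC x' x) (rC y' y) => *.
by rewrite ltr_norml; apply/andP; split; lra.
Qed.

Lemma continuous_pseudometric_nbhs rho x e :
  continuous_pseudometric rho -> 0 < e -> nbhs x [set y | rho x y < e].
Proof.
move=> [[_ rxx _ _] crho] e0.
have /cvgrPdist_lt/(_ e e0)[[A B] /= [xA xB] AB] := crho (x, x).
apply: filterS xB => y By; have /= := AB (x, y) (conj (nbhs_singleton xA) By).
by rewrite rxx sub0r normrN => /ltr_normlW.
Qed.

Lemma sup_pseudometric (rho : nat -> T -> T -> R) (c : R) :
  (forall n, pseudometric (rho n)) -> (forall n x y, rho n x y <= c) ->
  (forall x e, 0 < e -> nbhs x [set y | forall n, rho n x y <= e]) ->
  exists2 sigma : T -> T -> R, continuous_pseudometric sigma &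
    forall n x y, rho n x y <= sigma x y.
Proof.
move=> prho rhoc erho.
pose S x y := range (fun n => rho n x y).
have S0 x y : S x y !=set0 by exists (rho 0%N x y); exists 0%N.
have leS n x y : rho n x y <= sup (S x y).
  by apply: ub_le_sup; [exists c => _ [k _ <-] | exists n].
have Sle x y e : (forall n, rho n x y <= e) -> sup (S x y) <= e.
  by move=> xy; apply: ge_sup => // _ [n _ <-].
exists (fun x y => sup (S x y)) => //; apply: continuous_pseudometricP.
  split=> [x y|x|x y|x y z] /=.
  - by apply: le_trans (leS 0%N x y); case: (prho 0%N).
  - apply/eqP; rewrite eq_le; apply/andP; split.
      by apply: Sle => n; case: (prho n) => _ ->.
    by have := leS 0%N x x; case: (prho 0%N) => _ ->.
  - suff -> : S x y = S y x by [].
    by congr (_ @` _); apply/funext => n; case: (prho n).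
  - apply: Sle => n; have [_ _ _ /(_ x y z)/le_trans] := prho n; apply.
    by rewrite lerD.
move=> x e e0; have e2 : 0 < e / 2 by rewrite divr_gt0.
apply: filterS (erho x _ e2) => y xy /=; apply: le_lt_trans (Sle _ _ _ xy) _.
by lra.
Qed.

Lemma sup_pseudometric_vanishing (rho : nat -> T -> T -> R) (c : R) :
  (forall n, pseudometric (rho n)) -> (forall n x y, rho n x y <= c) ->
  (forall n x e, 0 < e -> nbhs x [set y | rho n x y < e]) ->
  (forall x e, 0 < e -> exists N,
    nbhs x [set y | forall n, (N <= n)%N -> rho n x y <= e]) ->
  exists2 sigma : T -> T -> R, continuous_pseudometric sigma &
    forall n x y, rho n x y <= sigma x y.
Proof.
move=> prho rhoc nrho trho; apply: sup_pseudometric prho rhoc _ => x e e0.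
have [N xN] := trho x e e0.
have xN' : nbhs x [set y | forall n, (n <= N)%N -> rho n x y < e].
  apply: (@filter_forall_le _ _ (fun n => [set y | rho n x y < e])) => n _.
  exact: nrho.
apply: filterS (filterI xN xN') => y [yN yN'] n.
by have [/ltnW/yN'/ltW//|/yN] := ltnP n N.
Qed.

Lemma min_pseudometric rho (c : R) : 0 <= c -> pseudometric rho ->
  pseudometric (fun x y => Num.min (rho x y) c).
Proof.
move=> c0 [r0 rxx rC rD]; split=> [x y|x|x y|x y z].
- by rewrite le_min r0.
- by rewrite rxx; apply/min_idPl.
- by rewrite rC.
- have := rD x y z; have := r0 x y; have := r0 y z.
  case: (leP (rho x y) c); case: (leP (rho y z) c); case: (leP (rho x z) c); lra.
Qed.

Section Hedgehog.
Variables (I : Type) (W : I -> set T) (q : T -> R).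
Hypotheses (Wdisj : forall s t y, W s y -> W t y -> s = t).
Hypotheses (q0 : forall y, 0 <= q y) (qW : forall y, q y != 0 -> exists s, W s y).

(** The hedgehog distance: points of a common set W s are compared by the
    values of q, and points of different sets through the centre, where q
    vanishes. *)
Definition hedgehog x y :=
  if pselect (exists s, W s x /\ W s y) then `|q x - q y| else q x + q y.

Lemma hedgehog_pseudometric : pseudometric hedgehog.
Proof.
split=> [x y|x|x y|x y z]; rewrite /hedgehog.
- by case: pselect => ? /=; [exact: normr_ge0 | exact: addr_ge0].
- case: pselect => [?|nW] /=; first by rewrite subrr normr0.
  have [->|/qW[s Ws]] := eqVneq (q x) 0; first by rewrite addr0.
  by case: nW; exists s.
- case: pselect => [[s [sx sy]]|nxy]; case: pselect => [[t [ty tx]]|nyx] //.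
  + exact: distrC.
  + by case: nyx; exists s.
  + by case: nxy; exists t.
  + exact: addrC.
- have := q0 x; have := q0 y; have := q0 z; have := ler_distD (q y) (q x) (q z).
  have lt_norm (a : R) : - a <= `|a| by rewrite -normrN; exact: ler_norm.
  have := ler_norm (q x - q y); have := ler_norm (q y - q z).
  have := lt_norm (q x - q y); have := lt_norm (q y - q z).
  case: pselect => [xz|nxz]; case: pselect => [xy|nxy];
    case: pselect => [yz|nyz] /= *; try lra; try
    by rewrite ler_norml; apply/andP; split; lra.
  + have [] : False.
    case: nxz; have [s [sx sy]] := xy; have [t [ty tz]] := yz; exists s.
    by rewrite {2}(Wdisj sy ty).
Qed.

Hypothesis oW : forall s, open (W s).
Hypothesis ctq : continuous q.

Lemma hedgehog_nbhs x (e : R) : 0 < e -> nbhs x [set y | hedgehog x y < e].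
Proof.
move=> e0; have qx : nbhs x [set y | `|q x - q y| < e].
  by have /cvgrPdist_lt/(_ e e0) := @ctq x.
have [qx0|/qW[s sx]] := eqVneq (q x) 0.
  apply: filterS qx => y /=; rewrite /hedgehog qx0 sub0r normrN add0r ger0_norm//.
  by case: pselect => ?.
have Ws : nbhs x (W s) by exact: open_nbhs_nbhs.
apply: filterS (filterI qx Ws) => y [qy sy] /=; rewrite /hedgehog.
by case: pselect => // -[]; exists s.
Qed.

Lemma hedgehog_lt1 x y : 1 <= q x -> hedgehog x y < 1 -> exists s, W s x /\ W s y.
Proof.
move=> qx; rewrite /hedgehog; case: pselect => //= ?; have := q0 y; lra.
Qed.

Lemma hedgehog_le x y : hedgehog x y <= q x + q y.
Proof.
rewrite /hedgehog; case: pselect => //= ?; have := q0 x; have := q0 y.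
by rewrite ler_norml => *; lra.
Qed.

End Hedgehog.

End Pseudometric.

Section LocallyFinite.
Context {R : realType} {T : topologicalType}.

(** q n compares h n with the maximum M n of the preceding functions.  It
    vanishes as soon as M n is at least 3/4, which happens near a point where
    h m = 1 for all n > m; and it is at least 1 for the first n with
    h n >= 1/2, since then M n <= 1/2. *)
Lemma locally_finite_functions (h : nat -> T -> R) :
  (forall n, continuous (h n)) -> (forall n y, 0 <= h n y <= 1) ->
  (forall y, exists n, h n y = 1) ->
  exists q : nat -> T -> R, [/\ forall n, continuous (q n),
    forall n y, 0 <= q n y <= 2,
    forall n y, q n y != 0 -> h n y != 0,
    forall y, exists n, 1 <= q n y &
    forall y : T, exists N, nbhs y [set z | forall n, (N <= n)%N -> q n z = 0]].
Proof.
move=> cth h01 h1.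
pose M := fix M n : T -> R := if n is k.+1 then M k \max h k else cst 0.
have ctM n : continuous (M n).
  elim: n => [|n IH] y; first exact: cvg_cst.
  by apply: continuous_max; [exact: IH | exact: cth].
have leM m n y : (m < n)%N -> h m y <= M n y.
  elim: n => // n IH; rewrite ltnS leq_eqVlt => /predU1P[->|/IH mn] /=.
    by rewrite le_max lexx orbT.
  by rewrite le_max mn.
have M01 n y : 0 <= M n y.
  by elim: n => //= n IH; rewrite le_max IH.
(* at most 2 h n, so the support of q n is contained in that of h n *)
pose q n : T -> R := cst 0 \max ((fun y => 2 * h n y) \min (fun y => 3 - 4 * M n y)).
exists q; split=> [n y|n y|n y|y|y].
- apply: continuous_max; first exact: cvg_cst.
  apply: continuous_min.
    by apply: cvgM; [exact: cvg_cst | exact: cth].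
  by apply: cvgB; [exact: cvg_cst | apply: cvgM; [exact: cvg_cst | exact: ctM]].
- have := h01 n y; rewrite /q/= => /andP[h0 h1n]; rewrite le_max lexx/=.
  by rewrite ge_max; apply/andP; split; [lra | rewrite ge_min; apply/orP; left; lra].
- apply: contra_neq => hn; rewrite /q/= hn mulr0; apply/max_idPl.
  by rewrite ge_min lexx.
- have exn : exists n, 2^-1 <= h n y.
    by have [n hn] := h1 y; exists n; rewrite hn; lra.
  case: (ex_minnP exn) => n hn nmin; exists n.
  have Mn : M n y <= 2^-1.
    have : forall k, (k <= n)%N -> M k y <= 2^-1.
      elim=> [|k IH] kn /=; first by lra.
      rewrite ge_max IH ?(ltnW kn)//=; apply/ltW; rewrite ltNge; apply/negP => /nmin.
      by rewrite leqNgt kn.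
    by apply.
  by rewrite /q/= le_max le_min; apply/orP; right; apply/andP; split; lra.
- have [m hm] := h1 y; exists m.+1.
  have : nbhs y [set z | `|h m y - h m z| < 4^-1].
    by have /cvgrPdist_lt/(_ 4^-1) := @cth m y; apply; lra.
  apply: filterS => z /=; rewrite hm => hz n mn.
  have hz' : 1 - h m z < 4^-1 by apply: le_lt_trans hz; exact: ler_norm.
  rewrite /q/=; apply/max_idPl; rewrite ge_min; apply/orP; right.
  have := leM _ _ z mn; lra.
Qed.

End LocallyFinite.

Section ClosedImage.
Context {R : realType} {X Y : topologicalType} (d : X -> X -> R) (f : X -> Y).
Hypotheses (dX : metrizes d) (cf : closed_map f) (ctf : continuous f).
Hypothesis sf : f @` setT = setT.

(** Balls of half the distance to the other set separate the preimages; their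
    dual images separate the sets. *)
Lemma closed_image_normal : normal_space Y.
Proof.
apply/(@normal_openP R) => A B cA cB AB.
have sep (C D : set Y) : closed D -> C `&` D = set0 -> exists r : X -> nat, 
    forall x, C (f x) -> forall z, D (f z) -> dyadic (r x) <= d x z.
  move=> cD CD.
  have rP x : exists n, C (f x) -> forall z, D (f z) -> dyadic n <= d x z.
    have [Cx|nCx] := pselect (C (f x)); last by exists 0%N.
    have xD : nbhs x (f @^-1` (~` D)).
      apply: ctf; apply: open_nbhs_nbhs; split; first exact: closed_openC.
      by move=> Dx; have : (C `&` D) (f x) by []; rewrite CD.
    have [n nD] := nbhs_dballP dX xD; exists n => _ z Dz.
    by rewrite leNgt; apply/negP => /nD.
  by have [r rP'] := choice rP; exists r.
have [r rP] := sep A B cB AB; have [s sP] := sep B A cA (etrans (setIC B A) AB).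
pose U := \bigcup_(x in f @^-1` A) dball d x (dyadic (r x).+1).
pose V := \bigcup_(x in f @^-1` B) dball d x (dyadic (s x).+1).
exists (small_image f U), (small_image f V); split.
- by apply: open_small_image => //; apply: bigcup_open => x _; exact: open_dball.
- by apply: open_small_image => //; apply: bigcup_open => x _; exact: open_dball.
- move=> y Ay x fx; exists x; first by rewrite /preimage/= fx.
  by apply: (dball_center dX); exact: dyadic_gt0.
- move=> y By x fx; exists x; first by rewrite /preimage/= fx.
  by apply: (dball_center dX); exact: dyadic_gt0.
- apply/seteqP; split=> // y [yU yV]; have [x fx] := surj_ex sf y.
  have [a Aa ax] := yU x fx; have [b Bb bx] := yV x fx.
  have := rP a Aa b Bb; have := sP b Bb a Aa; rewrite (distC dX b a).
  have := dist_triangle dX a x b; rewrite (distC dX x b).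
  have := dyadicS (R := R) (r a); have := dyadicS (R := R) (s b).
  move: ax bx; rewrite /dball/=; lra.
Qed.

Lemma open_image_Fsigma (W : set Y) : open W ->
  exists2 C : nat -> set Y, forall n, closed (C n) & W = \bigcup_n C n.
Proof.
move=> oW; exists (fun n => f @` [set x | dball d x (dyadic n) `<=` f @^-1` W]).
  move=> n; apply: cf => x clx z xz.
  have [|w [wW xw]] := clx (dball d x (dyadic n - d x z)).
    by apply: (nbhs_dball dX); rewrite subr_gt0.
  apply: wW; apply: le_lt_trans (dist_triangle dX w x z) _.
  by rewrite (distC dX) addrC -ltrBrDl.
apply/seteqP; split=> [y Wy|y [n _ [x xW <-]]].
  have [x fx] := surj_ex sf y.
  have [n nW] : exists n, dball d x (dyadic n) `<=` f @^-1` W.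
    by apply: nbhs_dballP => //; apply: ctf; rewrite fx; exact: open_nbhs_nbhs.
  by exists n => //; exists x.
by apply: xW; apply: (dball_center dX); exact: dyadic_gt0.
Qed.

(** Paracompactness of closed images of metric spaces.  Each of the countably
    many disjoint families of the refinement has an F_sigma union, hence is
    supported by countably many Urysohn functions, which are then made locally
    finite.  The supremum of the hedgehog distances is continuous, and a
    distance less than 1 forces two points into a common set of the
    refinement. *)
Theorem subordinate_pseudometric (N : Y -> set Y) : (forall y, nbhs y (N y)) ->
  exists2 rho : Y -> Y -> R, continuous_pseudometric rho &
    forall y z, rho y z < 1 -> exists2 w, N w y & N w z.
Proof.
move=> yN; have [||W [oW WN Wdisj cW]] :=
    sigma_disjoint_open_refinement dX cf ctf sf (U := fun y => (N y)°).
- by move=> y; exact: open_interior.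
- by move=> y; exists y; exact: yN.
have FsW i : exists C : nat -> set Y,
    (forall n, closed (C n)) /\ \bigcup_s W i s = \bigcup_n C n.
  have [|C cC WC] := @open_image_Fsigma (\bigcup_s W i s); last by exists C.
  by apply: bigcup_open.
have [C CP] := choice FsW.
have hP (p : nat * nat) : exists h : Y -> R, [/\ continuous h,
    forall y, 0 <= h y <= 1, forall y, h y != 0 -> exists s, W p.1 s y &
    forall y, C p.1 p.2 y -> h y = 1].
  have [cC WC] := CP p.1.
  have /(@uniform_separatorP _ R)[h [cth h01 h0 h1]] :
      uniform_separator (~` \bigcup_s W p.1 s) (C p.1 p.2).
    apply: ((@normal_separatorP R Y).1 closed_image_normal) => //.
      exact/open_closedC/bigcup_open.
    apply/disjoints_subset; rewrite WC; apply: subsetC => y Cy.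
    by exists p.2.
  exists h; split=> [//|y|y hy|y Cy].
  - by have /= := h01 (h y) (ex_intro2 _ _ y I erefl); rewrite in_itv.
  - apply: contrapT => nW; move: hy; rewrite (h0 (h y)) ?eqxx//.
    by exists y => // -[s _ Ws]; apply: nW; exists s.
  - by apply: h1; exists y.
have [h hP'] := choice hP.
pose decode j : nat * nat := odflt (0, 0)%N (unpickle j).
have [|||q [ctq q02 qh q1 qlf]] :=
    locally_finite_functions (h := fun j => h (decode j)).
- by move=> j; have [] := hP' (decode j).
- by move=> j y; have [_ + _ _] := hP' (decode j); exact.
- move=> y; have [i [s Wy]] := cW y; have [_ WC] := CP i.
  have [n _ Cy] : (\bigcup_n C i n) y by rewrite -WC; exists s.
  exists (pickle (i, n)); rewrite /decode pickleK /=.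
  by have [_ _ _] := hP' (i, n); exact.
have q0 j y : 0 <= q j y by have /andP[] := q02 j y.
have qW j y : q j y != 0 -> exists s, W (decode j).1 s y.
  by move=> /qh; have [_ _ + _] := hP' (decode j); exact.
have Wd j := Wdisj (decode j).1.
have [||||rho crho lerho] :=
    @sup_pseudometric_vanishing R Y (fun j => hedgehog (W (decode j).1) (q j)) 4.
- by move=> j; exact: (hedgehog_pseudometric (Wd j) (q0 j) (qW j)).
- move=> j x y; apply: le_trans (hedgehog_le (W (decode j).1) (q0 j) x y) _.
  by have /andP[_] := q02 j x; have /andP[_] := q02 j y; lra.
- move=> j x e e0; exact: (hedgehog_nbhs (q0 j) (qW j)).
- move=> x e e0; have [M xM] := qlf x; exists M.
  apply: filterS (xM) => y yM n Mn.
  apply: le_trans (hedgehog_le (W (decode n).1) (q0 n) x y) _.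
  by rewrite (nbhs_singleton xM)// yM// addr0 ltW.
exists rho => // y z yz; have [j qy] := q1 y.
have [s [sy sz]] := hedgehog_lt1 (q0 j) qy (le_lt_trans (lerho j y z) yz).
exists s; first exact: interior_subset (WN _ _ _ sy).
exact: interior_subset (WN _ _ _ sz).
Qed.

End ClosedImage.

(** * Perfect images and restrictions to closed sets *)

Section PerfectImage.
Context {R : realType} {X Y : topologicalType} (d : X -> X -> R) (f : X -> Y).
Hypotheses (dX : metrizes d) (cf : closed_map f) (ctf : continuous f).
Hypotheses (sf : f @` setT = setT) (T1Y : accessible_space Y).

Lemma metrizes_first_countable : first_countable X.
Proof.
move=> x; apply/first_countable_seq; exists (fun n => dball d x (dyadic n)) => [n|U].
  exact/(nbhs_dball dX)/dyadic_gt0.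
exact: (nbhs_dballP dX).
Qed.

(** Let N k y be the set of the points whose fibre lies within 2^-k of F_y,
    and let rho k be a pseudometric subordinate to N k.  If y and z lie in
    N k w for a large k, then F_w meets a small neighborhood of the compact
    set F_y; since f is closed, F_w and then F_z lie in a slightly larger one.
    So the rho k together generate the topology of Y. *)
Theorem perfect_image_metrizable :
  (forall y, compact (f @^-1` [set y])) -> metrizable R Y.
Proof.
move=> cF.
pose tube k y := \bigcup_(x in f @^-1` [set y]) dball d x (dyadic k).
pose N k y := small_image f (tube k y).
have yN k y : nbhs y (N k y).
  apply: nbhs_small_image => // x fx.
  by apply: filterS (nbhs_dball dX x (dyadic_gt0 k)) => z; exists x.
have tubeP y U : nbhs y U -> exists k, tube k y `<=` f @^-1` U.
  move=> yU.
  have [||k kU] := compact_lebesgue dX (P := fun V => V `<=` f @^-1` U) (cF y).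
  - by move=> V W VW /(subset_trans VW).
  - by move=> x fx; exists (f @^-1` U) => //; apply: ctf; rewrite fx.
  by exists k => z [x /kU xU] /xU.
have rhoP k : exists rho : Y -> Y -> R, continuous_pseudometric rho /\
    forall y z, rho y z < 1 -> exists2 w, N k w y & N k w z.
  have [rho crho rhoN] := subordinate_pseudometric dX cf ctf sf (yN k).
  by exists rho.
(* the truncation at 2^-k makes the supremum over k continuous *)
have {rhoP}[rho rhoP] := choice rhoP.
have dyadic1 k : dyadic k <= 1 :> R by exact: (@le_dyadic R 0 k).
have [||||sigma csigma lesigma] := @sup_pseudometric_vanishing R Y
    (fun k y z => Num.min (rho k y z) (dyadic k)) 1.
- move=> k; apply: min_pseudometric; first exact/ltW/dyadic_gt0.
  by have [[]] := rhoP k.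
- by move=> k y z; rewrite ge_min dyadic1 orbT.
- move=> k y e e0; have [crho _] := rhoP k.
  apply: filterS (continuous_pseudometric_nbhs y crho e0) => z.
  by rewrite /= gt_min => ->.
- move=> y e e0; have [k ke] := dyadic_lt e0; exists k.
  apply: filterE => z n kn; rewrite ge_min; apply/orP; right.
  by rewrite (le_trans (le_dyadic kn))// ltW.
have base y U : nbhs y U -> exists k, forall z, sigma y z < dyadic k -> U z.
  move=> /tubeP[m mU]; have [k1 k1U] := tubeP _ _ (yN m.+1 y).
  pose k := (maxn k1 m.+1); exists k => z yz.
  have /(rhoP k).2[w wy wz] : rho k y z < 1.
    have := le_lt_trans (lesigma k y z) yz; rewrite gt_min ltxx orbF.
    by move=> /lt_le_trans; apply.
  have [x [a aw ax] fx] := small_imageW sf wy.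
  have [x' [b bw bx'] <-] := small_imageW sf wz.
  have /(_ _ bw)[c cy cb] : N m.+1 y w.
    rewrite -[X in _ X]aw; apply: k1U; exists x => //.
    by rewrite /dball/= (distC dX) (lt_le_trans ax)// le_dyadic// leq_maxl.
  apply: mU; exists c => //; apply: le_lt_trans (dist_triangle dX c b x') _.
  by rewrite -(dyadicS m) ltrD// (lt_le_trans bx')// le_dyadic// leq_maxr.
exists sigma.
  split=> [|y z yz]; first by case: csigma.
  apply: contrapT => yz'; have [|k /(_ z)] := base y (~` [set z]).
    apply: open_nbhs_nbhs; split; last exact: yz'.
    exact/closed_openC/accessible_closed_set1.
  by rewrite yz; apply; [exact: dyadic_gt0 |].
move=> y; apply/seteqP; split=> [U /base[k kU]|U [e /= e0]].
  by exists (dyadic k); [exact: dyadic_gt0 | exact: kU].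
by move=> /filterS; apply; exact: continuous_pseudometric_nbhs.
Qed.

End PerfectImage.

Section Restriction.
Context {R : realType} {X Y : topologicalType} (d : X -> X -> R) (f : X -> Y).

Lemma set_type_metrizes (E : set X) : metrizes d ->
  metrizes (fun x y : E => d (set_val x) (set_val y)).
Proof.
move=> dX; split.
  split; last by move=> x y /(dist_eq0 dX)/val_inj.
  split=> *; [exact: (dist_ge0 dX) | exact: (distxx dX) | exact: (distC dX)|].
  exact: (dist_triangle dX).
move=> x; apply/seteqP; split=> [U /nbhs_set_typeP[V]|U [e /= e0 eU]].
  move=> /(nbhs_dballP dX)[n nV] VU; exists (dyadic n); first exact: dyadic_gt0.
  by move=> y /nV/VU.
apply/nbhs_set_typeP; exists (dball d (set_val x) e) => //.
exact: nbhs_dball.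
Qed.

Lemma set_type_accessible (C : set Y) : accessible_space Y -> accessible_space C.
Proof.
move=> T1 x y xy; have [|A [oA xA yA]] := T1 (set_val x) (set_val y).
  by apply: contra_neq xy => /val_inj.
rewrite !inE in xA yA; exists (set_val @^-1` A); split; rewrite ?inE//.
by apply: open_comp => // z _; exact: initial_continuous.
Qed.

Lemma set_type_compact (E K : set X) : compact (E `&` K) ->
  compact (set_val @^-1` K : set E).
Proof.
move=> cK F FF FK; have FEK : F (set_val @^-1` (E `&` K)).
  by apply: filterS FK => x Kx; split; [exact: set_valP | exact: Kx].
have [p [[Ep Kp] clp]] := cK (set_val @ F) _ FEK.
exists (exist _ p (mem_set Ep)); split => // A U FA /nbhs_set_typeP[V pV VU].
have FA' : F (set_val @^-1` (set_val @` A)).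
  by apply: filterS FA => x Ax; exists x.
have [_ [[x Ax <-] Vx]] := clp (set_val @` A) V FA' pV.
by exists x; split => //; exact: VU.
Qed.

Hypotheses (cf : closed_map f) (ctf : continuous f).

Definition restriction (E : set X) (x : E) : (f @` E : set Y) :=
  exist _ (f (set_val x)) (mem_set (imageP f (set_valP x))).

Lemma restriction_continuous E : continuous (@restriction E).
Proof.
move=> x U /nbhs_set_typeP[V xV VU]; apply/nbhs_set_typeP.
by exists (f @^-1` V) => [|z]; [exact: ctf | move=> Vz; exact: (VU (restriction z))].
Qed.

Lemma restriction_surjective E : @restriction E @` setT = setT.
Proof.
apply/seteqP; split=> // -[y yE] _; have [x Ex fx] := set_mem yE.
by exists (exist _ x (mem_set Ex)) => //; apply: val_inj.
Qed.

Lemma restriction_closed E : closed E -> closed_map (@restriction E).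
Proof.
move=> cE A /closed_openC[G oG GA].
have -> : @restriction E @` A = set_val @^-1` (f @` (E `&` ~` G)).
  apply/seteqP; split=> [_ [x Ax <-]|y [x [Ex Gx] fx]].
    exists (set_val x) => //; split; first exact: set_valP.
    by move=> Gx; have : (~` A) x by rewrite -GA.
  exists (exist _ x (mem_set Ex)); last exact: val_inj.
  apply: contrapT => nA; apply: Gx.
  by have : (~` A) (exist _ x (mem_set Ex)) by []; rewrite -GA.
apply: closed_comp => [y _|]; first exact: initial_continuous.
by apply: cf; apply: closedI => //; exact: open_closedC.
Qed.

Lemma restriction_compact_fiber E (c : f @` E) :
  compact (E `&` f @^-1` [set set_val c]) ->
  compact (@restriction E @^-1` [set c]).
Proof.
move=> /set_type_compact; congr compact; apply/seteqP.
split=> x /=; [by move=> xc; apply: val_inj | by move=> <-].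
Qed.

Hypothesis dX : metrizes d.

Lemma first_countable_closed_image E y : closed E ->
  compact (E `&` f @^-1` [set y]) -> first_countable_subspace_at (f @` E) y.
Proof.
move=> cE cEy c cy.
apply: (first_countable_compact_fiber (set_type_metrizes E dX)
  (restriction_closed cE) (@restriction_continuous E) (restriction_surjective E)).
by apply: restriction_compact_fiber; rewrite cy.
Qed.

Lemma metrizable_closed_image E : accessible_space Y -> closed E ->
  (forall y, compact (E `&` f @^-1` [set y])) -> metrizable R (f @` E).
Proof.
move=> T1 cE cEy; apply: (perfect_image_metrizable (set_type_metrizes E dX)
  (restriction_closed cE) (@restriction_continuous E) (restriction_surjective E)).
  exact: set_type_accessible.
by move=> c; apply: restriction_compact_fiber; exact: cEy.
Qed.

End Restriction.

(** * Inductive topologies *)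

Section FiniteUnions.
Context {T : topologicalType}.
Implicit Types K : nat -> set T.

Definition union_le K n := [set x | exists2 i, (i <= n)%N & K i x].

Lemma union_leS K n : union_le K n.+1 = union_le K n `|` K n.+1.
Proof.
apply/seteqP; split=> x.
  by case=> i; rewrite leq_eqVlt => /predU1P[->|]; [right | left; exists i].
by case=> [[i ? ?]|?]; [exists i => //; exact: leqW | exists n.+1].
Qed.

Lemma union_le0 K : union_le K 0 = K 0%N.
Proof.
apply/seteqP; split=> x; last by exists 0%N.
by case=> i; rewrite leqn0 => /eqP->.
Qed.

Lemma union_le_compact K n : (forall i, compact (K i)) -> compact (union_le K n).
Proof.
move=> cK; elim: n => [|n IH]; first by rewrite union_le0.
by rewrite union_leS; exact: compactU.
Qed.

Lemma union_le_closed K n : (forall i, closed (K i)) -> closed (union_le K n).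
Proof.
move=> cK; elim: n => [|n IH]; first by rewrite union_le0.
by rewrite union_leS; exact: closedU.
Qed.

End FiniteUnions.

Section LocalCompactness.
Context {R : realType} {X : topologicalType} (d : X -> X -> R).
Hypothesis dX : metrizes d.

Definition cball x n := [set z | d x z <= dyadic n].

Lemma closed_cball x n : closed (cball x n).
Proof.
move=> z clz; rewrite /cball/= leNgt; apply/negP => xz.
have [|w [xw zw]] := clz (dball d z (d x z - dyadic n)).
  by apply: (nbhs_dball dX); rewrite subr_gt0.
move: zw xw; rewrite /dball/cball/=.
have := dist_triangle dX x w z; rewrite (distC dX w z); lra.
Qed.

Lemma cball_subset x n : cball x n.+1 `<=` dball d x (dyadic n).
Proof.
move=> z /le_lt_trans; apply; rewrite -(dyadicS n) ltrDl; exact: dyadic_gt0.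
Qed.

Lemma locally_compact_subspaceI (F : set X) : closed F ->
  (forall x, F x -> exists K U,
     [/\ compact K, closed K, nbhs x U & F `&` U `<=` K]) ->
  locally_compact_subspace F.
Proof.
move=> cF FK c _; have [K [U [cK clK cU FUK]]] := FK (set_val c) (set_valP c).
exists (set_val @^-1` K).
  apply/nbhs_set_typeP; exists U => // x Ux _.
  by apply: FUK; split => //; exact: set_valP.
split; first by apply: set_type_compact; rewrite setIC; exact: compact_closedI.
by apply: closed_comp => // x _; exact: initial_continuous.
Qed.

Lemma locally_compact_subspace_cball (F : set X) x : closed F ->
  locally_compact_subspace F -> F x -> exists n, compact (F `&` cball x n).
Proof.
move=> cF lcF Fx; have [U + [cU _]] := lcF (exist _ x (mem_set Fx)) I.
move=> cU'; have /nbhs_set_typeP[V] : nbhs (exist _ x (mem_set Fx) : F) U.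
  by move: cU'; rewrite /within/=; apply: filterS => z; apply.
move=> /(nbhs_dballP dX)[n nV] VU; exists n.+1.
apply: (@subclosed_compact _ _ (set_val @` U)).
- by apply: closedI => //; exact: closed_cball.
- apply: continuous_compact => //; apply: continuous_subspaceT.
  exact: initial_continuous.
- move=> z [Fz /cball_subset/nV Vz]; exists (exist _ z (mem_set Fz)) => //.
  exact: VU.
Qed.

(** A finite union of closed balls with compact trace on F.  The sets E with
    compact trace are directed by inclusion, and the near-covering form of
    compactness is applied to the filter of their final segments. *)
Lemma compact_thickening (F K : set X) : closed F -> K `<=` F -> compact K ->
  locally_compact_subspace F ->
  exists E, [/\ closed E, compact (F `&` E) & forall x, K x -> nbhs x E].
Proof.
move=> cF KF /compact_near_coveringP cK lcF.
pose good E := closed E /\ compact (F `&` E).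
(* the filter of the final segments of the sets E that are good *)
pose Fil := [set P : set (set X) | exists2 E, good E &
  forall E', good E' -> E `<=` E' -> P E'].
have FFil : Filter Fil.
  split.
  - exists set0 => //; split; first exact: closed0.
    by rewrite setI0; exact: compact0.
  - move=> P Q [A [cA kA] AP] [B [cB kB] BQ]; exists (A `|` B).
      by split; [exact: closedU | rewrite setIUr; exact: compactU].
    by move=> E gE AE; split; [apply: AP | apply: BQ] => // z ?;
      apply: AE; [left | right].
  - by move=> P Q PQ [A gA AP]; exists A => // E gE AE; apply: PQ; exact: AP.
have [|E gE KE] := cK _ Fil (fun E x => nbhs x E) FFil.
  move=> x /KF Fx; have [n nF] := locally_compact_subspace_cball cF lcF Fx.
  exists (dball d x (dyadic n), [set E | cball x n `<=` E]).
    split; first exact/(nbhs_dball dX)/dyadic_gt0.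
    by exists (cball x n) => //; split => //; exact: closed_cball.
  move=> [z E]/= [xz nE]; apply: filterS (subset_trans _ nE) _.
    by move=> w; exact: ltW.
  by apply: open_nbhs_nbhs; split => //; exact: open_dball.
exists E; have [cE kE] := gE; split => // x Kx.
exact: (KE E gE (@subset_refl _ E) x Kx).
Qed.

End LocalCompactness.

Section Inductive.
Context {R : realType} {X Y : topologicalType} (d : X -> X -> R) (f : X -> Y).
Hypotheses (dX : metrizes d) (cf : closed_map f) (ctf : continuous f).
Hypotheses (irf : irreducible_map f) (T1Y : accessible_space Y).

Lemma closed_fiber y : closed (f @^-1` [set y]).
Proof.
by apply: closed_comp => [x _|]; [exact: ctf | exact: accessible_closed_set1].
Qed.

(** A set whose traces on the images f(E) are neighborhoods of y has a
    preimage that is a neighborhood of each point of the fibre having some E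
    as a neighborhood. *)
Lemma inductive_at_images (CC : set (set Y)) y :
  (forall x, f x = y -> exists2 E, nbhs x E & CC (f @` E)) -> inductive_at CC y.
Proof.
move=> nE U Uy; split=> [yU C _ c cy|CU].
  by apply/nbhs_set_typeP; exists U => //; rewrite cy.
apply/(nbhs_fiberP cf ctf irf.1) => x fx; have [E xE CE] := nE x fx.
have yE : (f @` E) y by exists x => //; exact: nbhs_singleton.
have /nbhs_set_typeP[V yV VU] := CU _ CE (exist _ y (mem_set yE)) erefl.
have xV : nbhs x (f @^-1` V) by apply: ctf; rewrite fx.
apply: filterS (filterI xE xV) => z [Ez Vz].
by apply: (VU (exist _ (f z) (mem_set (imageP f Ez)))).
Qed.

(** Otherwise the sequence (f (z n)) converges to y, while its complement is a
    neighborhood of y for the inductive topology, because the sequence visits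
    each C i containing y only finitely often. *)
Lemma inductive_at_capture (CC : set (set Y)) (C : nat -> set Y) y x (z : nat -> X) :
  (forall D, CC D -> exists n, C n = D) -> inductive_at CC y -> f x = y ->
  (forall n, d x (z n) < dyadic n) -> (forall n, f (z n) <> y) ->
  (forall n i, (i <= n)%N -> C i y -> ~ C i (f (z n))) -> False.
Proof.
move=> CCC ind fx xz zy zC.
have yU : nbhs y (~` range (f \o z)).
  apply/ind => [[n _] /zy//|D /CCC[i <-] c cy].
  apply/nbhs_set_typeP; exists (~` ((f \o z) @` `I_i)).
    rewrite cy; apply: open_nbhs_nbhs; split; last by move=> [n _] /zy.
    apply: closed_openC; apply: (accessible_finite_set_closed.1 T1Y).
    exact/finite_image/finite_II.
  move=> w Vw [n _ zw]; have [ni|] := ltnP n i; first by apply: Vw; exists n.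
  move=> /zC; apply; first by rewrite -cy; exact: set_valP.
  by have /= -> := zw; exact: set_valP.
have [n nU] : exists n, dball d x (dyadic n) `<=` f @^-1` (~` range (f \o z)).
  by apply: (nbhs_dballP dX); apply: ctf; rewrite fx.
by have := nU (z n) (xz n); apply; exists n.
Qed.

Lemma compact_fiber_frontier_subspace (C : set Y) y : C y ->
  first_countable_subspace_at C y ->
  compact (f @^-1` [set y] `&` closure (f @^-1` C `\` f @^-1` [set y])).
Proof.
move=> Cy /(_ (exist _ y (mem_set Cy)) erefl)/first_countable_seq[V yV VU].
have /choice[V' V'P] : forall n, exists V' : set Y, nbhs y V' /\
    forall z, V' z -> forall Cz : C z, V n (exist _ z (mem_set Cz)).
  move=> n; have /nbhs_set_typeP[V' yV' V'V] := yV n.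
  by exists V'; split => // z V'z Cz; exact: V'V.
apply: (compact_fiber_frontier dX cf ctf (V := V')).
- exact: accessible_closed_set1.
- by move=> n; have [] := V'P n.
- move=> U yU; have [|n nU] := VU (set_val @^-1` U).
    by apply/nbhs_set_typeP; exists U.
  exists n => z [V'z Cz].
  exact: (nU (exist _ z (mem_set Cz)) ((V'P n).2 z V'z Cz)).
Qed.

(** The part of the fibre of y that is approached from the preimage of C
    outside the fibre; it is made empty when C misses y, so that members of a
    cover need not be distinguished. *)
Definition frontier (C : set Y) y :=
  [set x | C y /\ (f @^-1` [set y] `&` closure (f @^-1` C `\` f @^-1` [set y])) x].

Lemma frontier_closed C y : closed (frontier C y).
Proof.
have [Cy|nCy] := pselect (C y).
  have -> : frontier C y =
      f @^-1` [set y] `&` closure (f @^-1` C `\` f @^-1` [set y]).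
    by apply/seteqP; split=> x => [[]|].
  by apply: closedI; [exact: closed_fiber | exact: closed_closure].
have -> : frontier C y = set0 by apply/seteqP; split=> x // [].
exact: closed0.
Qed.

Lemma frontier_compact C y :
  first_countable_subspace_at C y -> compact (frontier C y).
Proof.
move=> fcC; have [Cy|nCy] := pselect (C y).
  have -> : frontier C y =
      f @^-1` [set y] `&` closure (f @^-1` C `\` f @^-1` [set y]).
    by apply/seteqP; split=> x => [[]|].
  exact: compact_fiber_frontier_subspace.
have -> : frontier C y = set0 by apply/seteqP; split=> x // [].
exact: compact0.
Qed.

Lemma not_frontier_nbhs C y x : f x = y -> C y -> ~ frontier C y x ->
  nbhs x [set w | f w <> y -> ~ C (f w)].
Proof.
move=> fx Cy nfr; have : ~ closure (f @^-1` C `\` f @^-1` [set y]) x.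
  by move=> clx; apply: nfr.
move=> /existsNP[N /not_implyP[xN /set0P/negP/negPn/eqP N0]].
apply: filterS xN => w Nw wy Cw.
by suff : set0 w by []; rewrite -N0.
Qed.

(** Near any point, the fibre is contained in finitely many of the compact
    frontiers: otherwise points z_n off the fibre converge to the point and
    avoid the first n members of the cover that contain y. *)
Lemma fiber_locally_sigma_compact (CC : set (set Y)) y : countable CC ->
  (forall C, CC C -> first_countable_subspace_at C y) -> inductive_at CC y ->
  locally_compact_subspace (f @^-1` [set y]) /\ sigma_compact (f @^-1` [set y]).
Proof.
move=> /countable_sequence[C [CCC CC0]] fcC ind.
have cK n : compact (union_le (fun i => frontier (C i) y) n).
  apply: union_le_compact => i; have [/fcC|->] := CC0 i.
    exact: frontier_compact.
  have -> : frontier set0 y = set0 by apply/seteqP; split=> x // [].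
  exact: compact0.
have clK n : closed (union_le (fun i => frontier (C i) y) n).
  by apply: union_le_closed => i; exact: frontier_closed.
have [[x _ Fx]|Fy] := fiber_dichotomy irf (metrizes_accessible dX) y.
  split; last first.
    exists (fun=> [set x]) => [n|]; first exact: compact_set1.
    by rewrite Fx bigcup_const.
  apply: locally_compact_subspaceI => [|z Fz]; first exact: closed_fiber.
  exists [set x], setT; rewrite Fx; split.
  - exact: compact_set1.
  - by rewrite -Fx; exact: closed_fiber.
  - exact: filterT.
  - by move=> w [].
have loc x : f x = y -> exists n U, nbhs x U /\
    f @^-1` [set y] `&` U `<=` union_le (fun i => frontier (C i) y) n.
  move=> fx; apply: contrapT => noU.
  have step n : exists z, [/\ d x z < dyadic n, f z <> y &
      forall i, (i <= n)%N -> C i y -> ~ C i (f z)].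
    have [w [fw xw wK]] : exists w, [/\ f w = y, d x w < dyadic n &
        ~ union_le (fun i => frontier (C i) y) n w].
      apply: contrapT => now; apply: noU; exists n, (dball d x (dyadic n)).
      split; first exact/(nbhs_dball dX)/dyadic_gt0.
      by move=> w [fw xw]; apply: contrapT => wK; apply: now; exists w.
    have [|z [xz zC] zy] := Fy w (dball d x (dyadic n) `&`
        [set z | forall i, (i <= n)%N -> C i y -> f z <> y -> ~ C i (f z)]) fw.
      apply: filterI; first by apply: open_nbhs_nbhs; split => //; exact: open_dball.
      apply: (@filter_forall_le _ _
        (fun i => [set z | C i y -> f z <> y -> ~ C i (f z)])) => i iin.
      have [Ciy|nCiy] := pselect (C i y); last by apply: filterE => ? /nCiy.
      have := @not_frontier_nbhs (C i) y w fw Ciy.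
      move=> /(_ _)/wrap[|]; first by move=> wfr; apply: wK; exists i.
      by apply: filterS => ? ? _.
    by exists z; split => // i iin Ciy; exact: zC.
  have [z zP] := choice step.
  by apply: (inductive_at_capture (z := z) CCC ind fx) => n; have [] := zP n.
split.
  apply: locally_compact_subspaceI => [|x fx]; first exact: closed_fiber.
  have [n [U [xU UK]]] := loc x fx.
  by exists (union_le (fun i => frontier (C i) y) n), U; split.
exists (union_le (fun i => frontier (C i) y)) => //.
apply/seteqP; split=> [x fx|x [n _ [i _ [_ []]]]//].
have [n [U [xU UK]]] := loc x fx; exists n => //; apply: UK; split => //.
exact: nbhs_singleton.
Qed.

(** If F_y is the union of compact sets K n, closed sets E n with compact
    trace on F_y and containing K n in their interior are used.  The set of
    points at distance at least 2^-n from F_y is added to E n to make the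
    images cover Y. *)
Lemma locally_sigma_compact_fiber_cover y :
  locally_compact_subspace (f @^-1` [set y]) ->
  sigma_compact (f @^-1` [set y]) ->
  exists CC : set (set Y), [/\ countable_cover CC,
    forall C, CC C -> closed C /\ first_countable_subspace_at C y &
    inductive_at CC y].
Proof.
move=> lcF [K cK FK]; have clF := closed_fiber (y := y).
have /choice[E EP] : forall n, exists E : set X,
    [/\ closed E, compact (f @^-1` [set y] `&` E) & forall x, K n x -> nbhs x E].
  move=> n; apply: (compact_thickening dX clF _ (cK n) lcF).
  by rewrite FK; exact: bigcup_sup.
pose D n := ~` \bigcup_(x in f @^-1` [set y]) dball d x (dyadic n).
have cD n : closed (D n).
  by apply/open_closedC/bigcup_open => x _; exact: open_dball.
have DF n x : D n x -> f x <> y.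
  by move=> Dx fx; apply: Dx; exists x => //; exact/(dball_center dX)/dyadic_gt0.
have cED n : closed (E n `|` D n) by apply: closedU => //; have [] := EP n.
exists (range (fun n => f @` (E n `|` D n))); split.
- split; first exact: (card_le_trans (card_image_le _ _)).
  apply/seteqP; split=> // z _; have [x fx] := surj_ex irf.1 z.
  have [zy|zy] := pselect (z = y).
    have [n _ Knx] : (\bigcup_n K n) x by rewrite -FK /preimage/= fx.
    exists (f @` (E n `|` D n)); first by exists n.
    by exists x => //; left; have [_ _ /(_ _ Knx)/nbhs_singleton] := EP n.
  have /(nbhs_dballP dX)[n nF] : nbhs x (~` (f @^-1` [set y])).
    by apply: open_nbhs_nbhs; split; [exact: closed_openC | rewrite /preimage/= fx].
  exists (f @` (E n `|` D n)); first by exists n.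
  exists x => //; right => -[w fw]; rewrite /dball/= (distC dX) => xw.
  exact: nF xw fw.
- move=> _ [n _ <-]; split; first exact: cf.
  apply: (first_countable_closed_image cf ctf dX (cED n)).
  rewrite (_ : _ `&` _ = f @^-1` [set y] `&` E n); first by have [] := EP n.
  by apply/seteqP; split=> x [] => [[Ex|/DF Dx] //|fx Ex]; split => //; left.
- apply: inductive_at_images => x fx.
  have [n _ Knx] : (\bigcup_n K n) x by rewrite -FK.
  exists (E n `|` D n); last by exists n.
  by apply: filterS (@subsetUl _ _ _) _; have [_ _] := EP n; exact.
Qed.

Theorem inductive_at_fiberP y :
  ((exists CC : set (set Y),
      [/\ countable_cover CC,
          forall C, CC C -> first_countable_subspace_at C y &
          inductive_at CC y]) <->
   (locally_compact_subspace (f @^-1` [set y]) /\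
    sigma_compact (f @^-1` [set y]))) /\
  ((exists CC : set (set Y),
      [/\ countable_cover CC,
          forall C, CC C -> closed C /\ first_countable_subspace_at C y &
          inductive_at CC y]) <->
   (locally_compact_subspace (f @^-1` [set y]) /\
    sigma_compact (f @^-1` [set y]))).
Proof.
split; split=> [[CC [[cCC _] fcC ind]]|[lcF sF]].
- exact: fiber_locally_sigma_compact cCC fcC ind.
- have [CC [cCC fcC ind]] := locally_sigma_compact_fiber_cover lcF sF.
  by exists CC; split => // C /fcC[].
- by apply: fiber_locally_sigma_compact cCC _ ind => C /fcC[].
- exact: locally_sigma_compact_fiber_cover.
Qed.

(** The closures of the interiors of the preimages of finite unions of the
    members.  Outside nowhere dense fibres, such an interior is covered by the
    preimages, so its closure meets a fibre inside finitely many compact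
    frontiers; and the interiors exhaust X by the capture argument. *)
Lemma inductive_topology_exhaustion (CC : set (set Y)) : countable_cover CC ->
  (forall C, CC C -> closed C /\ first_countable C) -> inductive_topology CC ->
  exists Xn : nat -> set X,
    [/\ forall n, closed (Xn n),
        forall m n, (m <= n)%N -> Xn m `<=` Xn n,
        [set: X] = \bigcup_n (Xn n)° &
        forall n y, compact (Xn n `&` f @^-1` [set y])].
Proof.
move=> [/countable_sequence[C [CCC CC0]] covC] fcC ind.
pose G n := (f @^-1` union_le C n)°.
have oG n : open (G n) by exact: open_interior.
have cK n y : compact (union_le (fun i => frontier (C i) y) n).
  apply: union_le_compact => i; have [CCi|->] := CC0 i.
    by apply: frontier_compact => c _; have [_] := fcC _ CCi; exact.
  have -> : frontier set0 y = set0 by apply/seteqP; split=> x // [].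
  exact: compact0.
exists (fun n => closure (G n)); split.
- by move=> n; exact: closed_closure.
- move=> m n mn; apply/closureS/interiorS => x [i im Ci].
  by exists i => //; exact: leq_trans mn.
- apply/seteqP; split=> // x _; apply: contrapT => nGx.
  have [_ /CCC[i0 <-] Ci0] : (\bigcup_(D in CC) D) (f x) by rewrite covC.
  have step n : exists z, d x z < dyadic n /\ ~ union_le C (n + i0) (f z).
    apply: contrapT => noz; apply: nGx; exists (n + i0)%N => //.
    have Gx : G (n + i0)%N x.
      apply: filterS (nbhs_dball dX x (dyadic_gt0 n)) => z xz.
      by apply: contrapT => zC; apply: noz; exists z.
    apply: filterS (@subset_closure _ _) _; exact: open_nbhs_nbhs.
  have [z zP] := choice step.
  apply: (@inductive_at_capture _ C (f x) x z CCC (ind _) erefl) => n.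
  + by have [] := zP n.
  + move=> fz; have [_] := zP n; apply; rewrite fz; exists i0 => //.
    exact: leq_addl.
  + move=> i iin _ Ci; have [_] := zP n; apply; exists i => //.
    exact: leq_trans (leq_addr _ _).
- move=> n y; have [[x _ ->]|Fy] := fiber_dichotomy irf (metrizes_accessible dX) y.
    rewrite setIC; apply: compact_closedI; first exact: compact_set1.
    exact: closed_closure.
  apply: subclosed_compact (cK n y) _.
    by apply: closedI; [exact: closed_closure | exact: closed_fiber].
  move=> x [clx fx]; apply: contrapT => xK.
  pose N := [set w | forall i, (i <= n)%N -> f w <> y -> ~ C i (f w)].
  have xN : nbhs x N.
    apply: (@filter_forall_le _ _
      (fun i => [set w | f w <> y -> ~ C i (f w)])) => i iin.
    have [Ciy|nCiy] := pselect (C i y).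
      by apply: not_frontier_nbhs => // fr; apply: xK; exists i.
    have [CCi|->] := CC0 i; last by apply: filterE => ? _ [].
    have : nbhs x (f @^-1` (~` C i)).
      apply: ctf; apply: open_nbhs_nbhs; rewrite fx; split=> //.
      by apply: closed_openC; have [] := fcC _ CCi.
    by apply: filterS => ? ? _.
  have [w [Gw Nw]] := clx _ (nbhs_interior xN).
  have [v [Gv Nv] fv] : exists2 v, (G n `&` N) v & f v <> y.
    have [fw|fw] := pselect (f w = y); last first.
      by exists w => //; split => //; exact: interior_subset Nw.
    by apply: Fy fw _; apply: filterI => //; exact: open_nbhs_nbhs.
  have [i iin Ci] := interior_subset Gv; exact: (Nv i iin fv Ci).
Qed.

Lemma exhaustion_inductive_topology (Xn : nat -> set X) :
  (forall n, closed (Xn n)) -> [set: X] = \bigcup_n (Xn n)° ->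
  (forall n y, compact (Xn n `&` f @^-1` [set y])) ->
  exists CC : set (set Y),
    [/\ countable_cover CC,
        forall C : set Y, CC C -> closed C /\ metrizable R C &
        inductive_topology CC].
Proof.
move=> cX XE kX; exists (range (fun n => f @` Xn n)); split.
- split; first exact: (card_le_trans (card_image_le _ _)).
  apply/seteqP; split=> // y _; have [x fx] := surj_ex irf.1 y.
  have [n _ nx] : (\bigcup_n (Xn n)°) x by rewrite -XE.
  exists (f @` Xn n); first by exists n.
  by exists x => //; exact: interior_subset nx.
- move=> _ [n _ <-]; split; first exact: cf.
  exact: (metrizable_closed_image cf ctf dX T1Y).
- move=> y; apply: inductive_at_images => x fx.
  have [n _ nx] : (\bigcup_n (Xn n)°) x by rewrite -XE.
  by exists (Xn n) => //; exists n.
Qed.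

End Inductive.

Lemma metrizable_first_countable (R : realType) (T : topologicalType) :
  metrizable R T -> first_countable T.
Proof. by move=> [d dm dn]; exact: (@metrizes_first_countable R T d). Qed.

(** * A game criterion for sigma-compactness *)

Lemma mkseq_rcons (T : Type) (a : nat -> T) n :
  mkseq a n.+1 = rcons (mkseq a n) (a n).
Proof. by rewrite /mkseq -addn1 iotaD map_cat cats1. Qed.

Section Game.
Context {R : realType} {X : topologicalType} (d : X -> X -> R).
Hypothesis dX : metrizes d.
Variables (H : set X) (test : seq nat -> set X -> Prop).
Hypothesis cH : closed H.

(** The points of H at which tests at s exist in arbitrarily small
    neighborhoods.  A test at s is a finite set showing how large the sets of a
    base indexed by the extensions of s have to be: a single point off a fibre,
    or a pair of points with distinct images. *)
Definition testable s := [set x | H x /\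
  forall N, nbhs x N -> exists2 T, test s T & T `<=` N].

Definition locally_finite_tests (TT : set (set X)) := forall x, H x ->
  exists2 N, nbhs x N & finite_set (N `&` \bigcup_(T in TT) T).

Hypothesis finite_test : forall s T, test s T -> finite_set T.
Hypothesis testable_prefix :
  forall a x, H x -> exists n, testable (mkseq a n) x.
Hypothesis no_bar : forall TT, locally_finite_tests TT ->
  ~ (forall a, exists n, exists2 T, TT T & test (mkseq a n) T).

(** If, along some a, finitely many balls cover the testable points of each
    prefix, the centres of all these balls will do.  Otherwise the finite
    sequences for which this fails form a bar; enumerating them and choosing
    greedily separated testable points produces a locally finite family of
    tests meeting every branch. *)
Lemma countable_ball_cover (x0 : X) k : exists c : nat -> X,
  forall x, H x -> exists i, d (c i) x < dyadic k.
Proof.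
pose small s := exists l : seq X,
  forall x, testable s x -> exists2 c, c \in l & d c x < dyadic k.
have [[a sa]|] := pselect (exists a, forall n, small (mkseq a n)).
  have [l lP] := choice sa.
  exists (fun j =>
    let p : nat * nat := odflt (0, 0)%N (unpickle j) in nth x0 (l p.1) p.2).
  move=> x /(testable_prefix a)[n /lP[c cl cx]].
  by exists (pickle (n, index c (l n))); rewrite pickleK /= nth_index.
move=> nsmall; exfalso.
have pick (p : seq nat * seq X) : exists xT : X * set X, ~ small p.1 ->
    [/\ forall c, c \in p.2 -> dyadic k <= d c xT.1, test p.1 xT.2 &
        xT.2 `<=` dball d xT.1 (dyadic k.+2)].
  have [sp|nsp] := pselect (small p.1); first by exists (x0, set0).
  have [x [[Hx xT] xl]] : exists x, testable p.1 x /\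
      forall c, c \in p.2 -> dyadic k <= d c x.
    apply: contrapT => nox; apply: nsp; exists p.2 => x tx.
    apply: contrapT => xl; apply: nox; exists x; split => // c cl.
    by rewrite leNgt; apply/negP => cx; apply: xl; exists c.
  have [T tT Tx] := xT _ (nbhs_dball dX x (dyadic_gt0 k.+2)).
  by exists (x, T).
have {pick}[g gP] := choice pick.
pose code j : seq nat := odflt [::] (unpickle j).
pose L := fix L j := if j is i.+1 then (g (code i, L i)).1 :: L i else [::].
pose pt j := (g (code j, L j)).1; pose T j := (g (code j, L j)).2.
have ptL i j : (i < j)%N -> pt i \in L j.
  elim: j => // j IH; rewrite ltnS leq_eqVlt => /predU1P[->|/IH].
    by rewrite /= mem_head.
  by rewrite /= in_cons => ->; rewrite orbT.
apply: (@no_bar [set T j | j in [set j | ~ small (code j)]]).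
  move=> x _; exists (dball d x (dyadic k.+2)).
    exact/(nbhs_dball dX)/dyadic_gt0.
  pose N := dball d x (dyadic k.+2).
  have far i j z w : ~ small (code i) -> ~ small (code j) -> (i < j)%N ->
      N z -> N w -> T i z -> T j w -> False.
    move=> si sj ij xz xw Tz Tw.
    have [_ _ /(_ z Tz) iz] := gP (code i, L i) si.
    have [/(_ _ (ptL _ _ ij)) ij' _ /(_ w Tw) jw] := gP (code j, L j) sj.
    move: xz xw iz jw ij'; rewrite /N/dball/= -/(pt i) -/(pt j).
    have := dist_triangle dX (pt i) x (pt j); have := dist_triangle dX (pt i) z x.
    have := dist_triangle dX x w (pt j); rewrite (distC dX z x) (distC dX w (pt j)).
    have := dyadicS (R := R) k; have := dyadicS (R := R) k.+1; lra.
  have [[i [si [z [xz Tz]]]]|none] :=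
      pselect (exists i, ~ small (code i) /\ exists z, N z /\ T i z).
    apply: (@sub_finite_set _ _ (T i)).
      move=> w [xw [_ [j sj <-] Tw]].
      have [ij|ji|->//] := ltngtP i j.
        by have := far i j z w si sj ij xz xw Tz Tw.
      by have := far j i w z sj si ji xw xz Tw Tz.
    by apply: (@finite_test (code i)); have [] := gP (code i, L i) si.
  apply: (@sub_finite_set _ _ set0) => // w [xw [_ [j sj <-] Tw]].
  by apply: none; exists j; split => //; exists w.
move=> a; have [n sn] : exists n, ~ small (mkseq a n).
  by apply: contrapT => ns; apply: nsmall; exists a => n;
    apply: contrapT => sn; apply: ns; exists n.
have cn : code (pickle (mkseq a n)) = mkseq a n by rewrite /code pickleK.
exists n; exists (T (pickle (mkseq a n))).
  by exists (pickle (mkseq a n)); rewrite //= cn.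
by have := gP (mkseq a n, L (pickle (mkseq a n))) sn; rewrite /T cn => -[].
Qed.

Lemma countable_closed_base : H !=set0 -> exists B : nat -> set X,
  (forall i, closed (B i)) /\
  forall x U, H x -> nbhs x U -> exists i, nbhs x (B i) /\ B i `<=` U.
Proof.
move=> [x0 _]; have [c cP] := choice (countable_ball_cover x0).
pose code j : nat * nat := odflt (0, 0)%N (unpickle j).
exists (fun j => cball d (c (code j).1 (code j).2) (code j).1); split=> [i|x U Hx].
  exact: closed_cball.
move=> /(nbhs_dballP dX)[m mU]; have [i ci] := cP m.+1 x Hx.
exists (pickle (m.+1, i)); rewrite /code pickleK /=; split.
  apply: (@filterS _ _ _ (dball d (c m.+1 i) (dyadic m.+1))) => [z /ltW//|].
  by apply: open_nbhs_nbhs; split => //; exact: open_dball.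
move=> z cz; apply: mU; rewrite /dball/= -dyadicS.
apply: le_lt_trans (dist_triangle dX x (c m.+1 i) z) _.
by rewrite (distC dX) ltr_leD.
Qed.

Section Play.
Variable B : nat -> set X.
Hypothesis cB : forall i, closed (B i).

Definition covered (l : seq nat) := [set x | exists2 i, i \in l & B i x].

Definition covering (O : nat -> seq nat) := forall x, H x ->
  exists2 N, nbhs x N & exists k, forall j, (k <= j)%N -> N `<=` covered (O j).

(** The positions from which the first player can force a win, as an inductive
    predicate: s records the answers of the second player and l lists the balls
    claimed so far. *)
Inductive losing : seq nat -> seq nat -> Prop :=
| losing_now s l x : testable s x -> ~ covered l x -> losing s l
| losing_later s l O : covering O ->
    (forall k, losing (rcons s k) (l ++ O k)) -> losing s l.

Lemma closed_covered l : closed (covered l).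
Proof.
elim: l => [|i l IH].
  have -> : covered [::] = set0 by apply/seteqP; split=> x // [].
  exact: closed0.
have -> : covered (i :: l) = B i `|` covered l; last exact: closedU.
apply/seteqP; split=> x.
  by move=> [j]; rewrite in_cons => /predU1P[->|jl] Bx; [left | right; exists j].
by move=> [Bx|[j jl Bx]]; [exists i | exists j] => //;
  rewrite in_cons ?eqxx ?jl ?orbT.
Qed.

(** Tests are collected at the leaves of a winning strategy.  They remain
    outside the closed sets claimed before, and a covering move confines all
    but finitely many of its branches away from a given point, which gives
    local finiteness. *)
Lemma losing_tests s l : losing s l -> exists TT : set (set X),
  [/\ forall T, TT T -> T `<=` ~` covered l, locally_finite_tests TT &
      forall a, mkseq a (size s) = s ->
        exists n, exists2 T, TT T & test (mkseq a n) T].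
Proof.
elim=> {s l} [s l x [Hx sx] lx|s l O coverO _ IH].
  have [|T sT Tl] := sx (~` covered l).
    by apply: open_nbhs_nbhs; split => //; exact/closed_openC/closed_covered.
  exists [set T]; split=> [_ ->//|y _|a sa].
    exists setT; first exact: filterT.
    by rewrite setTI bigcup_set1; exact: finite_test sT.
  by exists (size s); exists T => //; rewrite sa.
have [TT TTP] := choice IH.
exists (\bigcup_k TT k); split=> [T [k _ TTk]|x Hx|a sa].
- have [/(_ _ TTk) + _ _] := TTP k => /subset_trans; apply; apply: subsetC.
  by move=> x [i il Bx]; exists i => //; rewrite mem_cat il.
- have [N xN [m Nm]] := coverO x Hx.
  have /choice[N' N'P] : forall k, exists N', nbhs x N' /\
      finite_set (N' `&` \bigcup_(T in TT k) T).
    by move=> k; have [_ /(_ x Hx)[N' xN' fN'] _] := TTP k; exists N'.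
  exists (N `&` [set y | forall k, (k <= m)%N -> N' k y]).
    apply: filterI => //; apply: (@filter_forall_le _ _ N') => k _.
    by have [] := N'P k.
  apply: (@sub_finite_set _ _ (\bigcup_(k in `I_m) (N' k `&` \bigcup_(T in TT k) T))).
    move=> y [[Ny N'y] [T [k _ TTk] Ty]]; have [km|mk] := ltnP k m.
      by exists k => //; split; [apply: N'y; exact: ltnW | exists T].
    have [/(_ _ TTk _ Ty) + _ _] := TTP k; case.
    by have [i iO By] := Nm _ mk _ Ny; exists i => //; rewrite mem_cat iO orbT.
  apply: bigcup_finite; first exact: finite_II.
  by move=> k _; have [] := N'P k.
- have [_ _ /(_ a)] := TTP (a (size s)).
  rewrite size_rcons mkseq_rcons sa => /(_ erefl)[n [T TTT tT]].
  by exists n; exists T => //; exists (a (size s)).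
Qed.

Lemma not_losing_start : ~ losing [::] [::].
Proof.
move=> /losing_tests[TT [_ lfTT barTT]]; apply: (no_bar lfTT) => a.
exact: barTT.
Qed.

(** The points outside the balls claimed so far that every non-losing answer
    covers. *)
Definition residue s l := [set x | [/\ H x, ~ covered l x &
  forall k l', ~ losing (rcons s k) l' -> covered l' x]].

(** Otherwise the second player could move forever through non-losing
    positions without covering x; some prefix of the resulting branch captures
    x, and that position is lost. *)
Lemma residue_cover x : H x -> exists s l, ~ losing s l /\ residue s l x.
Proof.
move=> Hx; apply: contrapT => noK.
pose good (p : seq nat * seq nat) := ~ losing p.1 p.2 /\ ~ covered p.2 x.
have step p : exists kl : nat * seq nat, good p -> good (rcons p.1 kl.1, kl.2).
  have [[pl px]|np] := pselect (good p); last by exists (0%N, [::]).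
  apply: contrapT => nokl; apply: noK; exists p.1, p.2; split => //.
  split => // k l' kl'; apply: contrapT => nx.
  by apply: nokl; exists (k, l').
have [g gP] := choice step.
pose st := fix st n := if n is m.+1 then (rcons (st m).1 (g (st m)).1, (g (st m)).2)
                       else ([::], [::]).
pose a n := (g (st n)).1.
have stE n : (st n).1 = mkseq a n by elim: n => // n IH; rewrite mkseq_rcons /= IH.
have goodst n : good (st n).
  elim: n => [|n IH]; last exact: gP.
  by split; [exact: not_losing_start | case].
have [n na] := testable_prefix a Hx; have [nl nx] := goodst n.
by apply: nl; rewrite stE; exact: losing_now na nx.
Qed.

Hypothesis baseB : forall x U, H x -> nbhs x U ->
  exists i, nbhs x (B i) /\ B i `<=` U.

(** Against an escaping sequence of the residue, the first player presents, as
    k-th family, those of the first k basic sets that miss the sequence from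
    rank k on.  Some answer k is not losing, so the k-th point of the sequence should be
    covered, which is impossible. *)
Lemma residue_compact s l : ~ losing s l -> compact (closure (residue s l)).
Proof.
move=> nsl; apply: (compact_closure_seq dX) => x Kx ex; apply: nsl.
pose O k := [seq i <- iota 0 k | `[< forall j, (k <= j)%N -> ~ B i (x j) >]].
apply: (@losing_later _ _ O) => [p Hp|k].
  have [U pU [m mU]] := ex p; have [i [pi iU]] := baseB Hp pU.
  exists (B i) => //; exists (maxn i.+1 m) => k; rewrite geq_max => /andP[ik mk] z Bz.
  exists i => //; rewrite mem_filter mem_iota /= ik andbT.
  by apply/asboolP => j kj /iU; apply: mU; exact: leq_trans kj.
apply: contrapT => nk; have [_ nlx /(_ _ _ nk)[i]] := Kx k.
rewrite mem_cat => /orP[il Bx|]; first by apply: nlx; exists i.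
by rewrite mem_filter => /andP[/asboolP/(_ k (leqnn k))].
Qed.

End Play.

Theorem sigma_compact_of_tests : sigma_compact H.
Proof.
have [H0|/set0P Hn] := eqVneq H set0.
  by exists (fun=> set0) => [_|]; [exact: compact0 | rewrite H0 bigcup_const].
have [B [cB baseB]] := countable_closed_base Hn.
pose code j : seq nat * seq nat := odflt ([::], [::]) (unpickle j).
exists (fun j => if pselect (losing B (code j).1 (code j).2) then set0
                 else closure (residue B (code j).1 (code j).2)).
  move=> j; case: pselect => [_|nl] /=; first exact: compact0.
  exact: residue_compact.
apply/seteqP; split=> [x /(residue_cover cB)[s [l [nl Kx]]]|x [j _]].
  exists (pickle (s, l)) => //; rewrite /code pickleK /=.
  by case: pselect => // ? /=; exact: subset_closure.
case: pselect => // nl /=; rewrite [X in _ -> X x](closure_id H).1//.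
by apply: closureS => y [].
Qed.

End Game.

(** * Bases indexed by omega^omega *)

Section OmegaBase.
Context {Z : Type} (V : (nat -> nat) -> set Z).

(** What the finite prefix s guarantees: the points common to all V b with b
    extending s. *)
Definition prefix_core (s : seq nat) :=
  [set z | forall b, mkseq b (size s) = s -> V b z].

Lemma prefix_core_mkseq b n : prefix_core (mkseq b n) `<=` V b.
Proof. by move=> z; apply; rewrite size_mkseq. Qed.

Hypothesis Vmono : forall a b, (forall n, (a n <= b n)%N) -> V b `<=` V a.

(** Each n gives some b n that agrees with a below n and with z n outside
    V (b n); at each coordinate only finitely many of these sequences differ
    from a, so they have a common upper bound. *)
Lemma prefix_core_avoid a (z : nat -> Z) :
  (forall n, ~ prefix_core (mkseq a n) (z n)) -> exists b, forall n, ~ V b (z n).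
Proof.
move=> za; have /choice[b bP] : forall n, exists b,
    mkseq b n = mkseq a n /\ ~ V b (z n).
  move=> n; apply: contrapT => nob; apply: (za n) => b; rewrite size_mkseq => ba.
  by apply: contrapT => nV; apply: nob; exists b.
exists (fun k => maxn (a k) (\max_(n < k.+1) b n k)) => n.
apply: contra_not (bP n).2; apply: Vmono => k; rewrite leq_max.
have [kn|nk] := ltnP k n.
  have := (bP n).1 => /(congr1 (nth 0%N ^~ k)); rewrite !nth_mkseq// => ->.
  by rewrite leqnn.
apply/orP; right; have nk' : (n < k.+1)%N by [].
exact: (@leq_bigmax _ (fun i : 'I_k.+1 => b i k) (Ordinal nk')).
Qed.

End OmegaBase.

Section Fibers.
Context {R : realType} {X Y : topologicalType} (d : X -> X -> R) (f : X -> Y).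
Hypotheses (dX : metrizes d) (cf : closed_map f) (ctf : continuous f).
Hypotheses (irf : irreducible_map f) (T1Y : accessible_space Y).

Lemma nbhs_setD_finite (N A : set X) x : nbhs x N -> finite_set (N `&` A) ->
  ~ A x -> nbhs x (~` A).
Proof.
move=> xN fNA Ax; have xNA : nbhs x (~` (N `&` A)).
  apply: open_nbhs_nbhs; split; last by case.
  apply: closed_openC.
  exact: (accessible_finite_set_closed.1 (metrizes_accessible dX)).
by apply: filterS (filterI xN xNA) => w [Nw NAw] Aw; exact: NAw.
Qed.

(** The tests at s are the points off the fibre whose image is in V s.  A
    locally finite family of tests misses a neighborhood of the fibre, hence
    is missed by some V b. *)
Lemma omega_base_sigma_compact y :
  omega_omega_base (nbhs y) -> sigma_compact (f @^-1` [set y]).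
Proof.
move=> [V [yV baseV monoV]].
have [[x _ ->]|Fy] := fiber_dichotomy irf (metrizes_accessible dX) y.
  by exists (fun=> [set x]) => [n|]; [exact: compact_set1 | rewrite bigcup_const].
pose test s T := exists z, [/\ T = [set z], f z <> y & prefix_core V s (f z)].
apply: (@sigma_compact_of_tests _ _ d dX _ test).
- exact: closed_fiber.
- by move=> s T [z [-> _ _]]; exact: finite_set1.
- move=> a x fx.
  have [n xn] : exists n, nbhs x (f @^-1` prefix_core V (mkseq a n)).
    apply: contrapT => nox.
    have /choice[z zP] : forall n, exists z,
        d x z < dyadic n /\ ~ prefix_core V (mkseq a n) (f z).
      move=> n; apply: contrapT => noz; apply: nox; exists n.
      apply: filterS (nbhs_dball dX x (dyadic_gt0 n)) => z xz.
      by apply: contrapT => nz; apply: noz; exists z.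
    have [b bz] := prefix_core_avoid monoV (fun n => (zP n).2).
    have [n nV] : exists n, dball d x (dyadic n) `<=` f @^-1` (V b).
      by apply: (nbhs_dballP dX); apply: ctf; rewrite fx.
    by apply: (bz n); apply: nV; have [] := zP n.
  exists n; split=> // N xN; have [z [Nz cz] fz] := Fy x _ fx (filterI xN xn).
  by exists [set z]; [exists z | move=> _ ->].
- move=> TT lfTT bar; pose Z := [set z | (\bigcup_(T in TT) T) z /\ f z <> y].
  have yZ : nbhs y (small_image f (~` Z)).
    apply: nbhs_small_image => // x fx; have [N xN fN] := lfTT x fx.
    apply: (nbhs_setD_finite xN); last by case.
    by apply: sub_finite_set fN => w [Nw [Tw _]].
  have [b bZ] := baseV _ yZ; have [n [T TTT [z [Tz fz bz]]]] := bar b.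
  apply: (bZ _ (prefix_core_mkseq bz) z erefl); split => //.
  by exists T => //; rewrite Tz.
Qed.

(** The coordinate a n is the radius, as a power of 1/2, of the neighborhood
    of the n-th compact set. *)
Lemma sigma_compact_omega_base y :
  sigma_compact (f @^-1` [set y]) -> omega_omega_base (nbhs y).
Proof.
move=> [K cK FK].
have KF n x : K n x -> f x = y.
  by move=> Kx; have : (f @^-1` [set y]) x by rewrite FK; exists n.
exists (fun a =>
  small_image f (\bigcup_n \bigcup_(x in K n) dball d x (dyadic (a n)))).
split=> [a|U yU|a b ab z zb x /zb[n _ [c Kc cx]]].
- apply: nbhs_small_image => // x fx.
  have [n _ Kx] : (\bigcup_n K n) x by rewrite -FK.
  apply: filterS (nbhs_dball dX x (dyadic_gt0 (a n))) => z xz.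
  by exists n => //; exists x.
- have /choice[a aP] : forall n, exists k, forall x, K n x ->
      dball d x (dyadic k) `<=` f @^-1` U.
    move=> n; apply: (compact_lebesgue dX (P := fun V => V `<=` f @^-1` U) (cK n)).
      by move=> V W VW /(subset_trans VW).
    by move=> x /KF fx; exists (f @^-1` U) => //; apply: ctf; rewrite fx.
  exists a => z /(small_imageW irf.1)[x [n _ [c Kc cx]] <-].
  exact: aP Kc _ cx.
- exists n => //; exists c => //; apply: lt_le_trans cx _; exact: le_dyadic.
Qed.

Theorem omega_base_fiberP y :
  omega_omega_base (nbhs y) <-> sigma_compact (f @^-1` [set y]).
Proof.
by split; [exact: omega_base_sigma_compact | exact: sigma_compact_omega_base].
Qed.

(** Paracompactness of Y: the universal uniformity consists of all the
    neighborhoods of the diagonal. *)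
Lemma universal_uniformityP (D : set (Y * Y)) :
  universal_uniformity R D <->
  forall y : Y, exists2 N, nbhs y N & N `*` N `<=` D.
Proof.
split=> [[rho crho rhoD] y|DN].
  exists [set z | rho y z < 1 / 2].
    by apply: continuous_pseudometric_nbhs => //; lra.
  move=> [z z'] /= [yz yz']; apply: rhoD => /=; case: crho => -[_ _ rC rD] _.
  by have := rD z y z'; rewrite (rC z y); lra.
have /choice[N NP] : forall y : Y, exists N : set Y, nbhs y N /\ N `*` N `<=` D.
  by move=> y; have [N yN ND] := DN y; exists N.
have [rho crho rhoN] :=
  subordinate_pseudometric dX cf ctf irf.1 (fun y => (NP y).1).
exists rho => // -[z z'] /= /rhoN[w wz wz'].
by apply: (NP w).2.
Qed.

Lemma isolated_setTP (T : topologicalType) (x : T) :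
  isolated [set: T] x <-> nbhs x [set x].
Proof.
split=> [[_ [V xV]]|xx]; first by rewrite setIT => <-.
by split; [exact: in_setT | exists [set x] => //; rewrite setIT].
Qed.

Lemma closed_nonisolated : closed (~` isolated [set: X]).
Proof.
apply: open_closedC; rewrite openE => x /isolated_setTP xx.
by apply: filterS (xx) => _ ->; exact/isolated_setTP.
Qed.

Lemma nonisolated_separate x N : ~ isolated [set: X] x -> nbhs x N ->
  exists2 z, N z & f z <> f x.
Proof.
move=> nx xN.
have [[x0 x0x0 Fx]|Fx] := fiber_dichotomy irf (metrizes_accessible dX) (f x).
  have : [set x0] x by rewrite -Fx.
  by move=> xx0; case: nx; apply/isolated_setTP; rewrite xx0.
exact: Fx.
Qed.

(** The tests at s are the pairs of points with distinct images that V s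
    identifies.  For each y, the points of the pairs outside F_y form a closed
    set containing a point of each pair, so the complement of the set of image
    pairs is a neighborhood of the diagonal. *)
Lemma universal_omega_sigma'_compact :
  universally_omega_omega_based R Y -> sigma'_compact X.
Proof.
move=> [V [unifV baseV monoV]].
pose test s T := exists z z',
  [/\ T = [set z; z'], f z <> f z' & prefix_core V s (f z, f z')].
apply: (@sigma_compact_of_tests _ _ d dX _ test).
- exact: closed_nonisolated.
- by move=> s T [z [z' [-> _ _]]]; exact: finite_set2.
- move=> a x nx.
  have [n xn] : exists n, forall z z', d x z < dyadic n -> d x z' < dyadic n ->
      prefix_core V (mkseq a n) (f z, f z').
    apply: contrapT => nox.
    have /choice[z zP] : forall n, exists z : X * X,
        [/\ d x z.1 < dyadic n, d x z.2 < dyadic n &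
            ~ prefix_core V (mkseq a n) (f z.1, f z.2)].
      move=> n; apply: contrapT => noz; apply: nox; exists n => z z' xz xz'.
      by apply: contrapT => nz; apply: noz; exists (z, z').
    have [|b bz] :=
        prefix_core_avoid monoV (a := a) (z := fun n => (f (z n).1, f (z n).2)).
      by move=> n; have [] := zP n.
    have [N xN NV] := (universal_uniformityP _).1 (unifV b) (f x).
    have [n nN] := nbhs_dballP dX (ctf xN).
    apply: (bz n); apply: NV; have [z1 z2 _] := zP n.
    by split; exact: nN.
  exists n; split=> // N xN.
  have [|z [Nz xz] fz] := nonisolated_separate nx (N := N `&` dball d x (dyadic n)).
    exact/filterI/(nbhs_dball dX)/dyadic_gt0.
  exists [set z; x]; last by move=> _ [->|->] //; exact: nbhs_singleton.
  exists z, x; split => //; apply: xn => //.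
  by rewrite (distxx dX) dyadic_gt0.
- move=> TT lfTT bar; pose Z := \bigcup_(T in TT) T.
  pose D := ~` [set yy | exists z z', [/\ Z z, Z z', f z <> f z' & yy = (f z, f z')]].
  have /baseV[b bD] : universal_uniformity R D.
    apply/universal_uniformityP => y.
    exists (small_image f (~` [set z | Z z /\ f z <> y])).
      apply: nbhs_small_image => // x fx.
      have [N xN fN] : exists2 N, nbhs x N & finite_set (N `&` Z).
        have [/isolated_setTP xx|nx] := pselect (isolated [set: X] x).
          by exists [set x] => //; apply: (sub_finite_set _ (finite_set1 x)) => w [].
        exact: lfTT.
      apply: (nbhs_setD_finite xN); last by case.
      by apply: sub_finite_set fN => w [Nw [Zw _]].
    move=> [w w'] /= [yw yw'] [z [z' [Zz Zz' zz' [wz wz']]]].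
    have fy v u : small_image f (~` [set z | Z z /\ f z <> y]) u ->
        Z v -> f v = u -> f v = y.
      by move=> yu Zv fv; apply: contrapT => vy; exact: (yu v fv).
    apply: zz'; rewrite (fy z w)//.
    by apply/esym; exact: (fy z' w').
  have [n [T TTT [z [z' [Tz zz' bz]]]]] := bar b.
  apply: (bD _ (prefix_core_mkseq bz)); exists z, z'.
  split => //; exists T => //; rewrite Tz.
    by left.
  by right.
Qed.

(** The coordinate a n controls the size of balls around the n-th compact set
    of non-isolated points; isolated points need no thickening.  A point close
    to y in the sense of N a is joined to y by one such ball, so that rho is
    less than 1/2 between them. *)
Lemma sigma'_compact_universal_omega :
  sigma'_compact X -> universally_omega_omega_based R Y.
Proof.
move=> [K cK XK].
pose ngh a x := [set w | w = x \/ exists n c,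
  [/\ K n c, d c x < dyadic (a n) & d c w < dyadic (a n)]].
pose N a y := small_image f (\bigcup_(x in f @^-1` [set y]) ngh a x).
have yN a y : nbhs y (N a y).
  apply: nbhs_small_image => // x fx.
  have [/isolated_setTP xx|nx] := pselect (isolated [set: X] x).
    by apply: filterS xx => _ ->; exists x => //; left.
  have [n _ Kx] : (\bigcup_n K n) x by rewrite -XK.
  apply: filterS (nbhs_dball dX x (dyadic_gt0 (a n))) => w xw.
  exists x => //; right; exists n, x; split => //.
  by rewrite (distxx dX) dyadic_gt0.
exists (fun a => \bigcup_y (N a y `*` N a y)); split=> [a|U [rho crho rhoU]|a b ab].
- by apply/universal_uniformityP => y; exists (N a y) => // z Nz; exists y.
- have [[r0 rxx rC rD] _] := crho.
  have /choice[a aP] : forall n, exists k, forall c, K n c ->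
      forall w w', d c w < dyadic k -> d c w' < dyadic k -> rho (f w) (f w') < 1 / 2.
    move=> n; apply: (compact_lebesgue dX (P := fun V => forall w w', V w -> V w' ->
        rho (f w) (f w') < 1 / 2) (cK n)).
      by move=> V W VW Wrho w w' /VW + /VW; exact: Wrho.
    move=> x Kx; exists (f @^-1` [set z | rho (f x) z < 1 / 4]).
      by apply: ctf; apply: continuous_pseudometric_nbhs => //; lra.
    move=> w w' /= xw xw'; have := rD (f w) (f x) (f w'); rewrite (rC (f w) (f x)).
    lra.
  have close y z : N a y z -> rho y z < 1 / 2.
    move=> /(small_imageW irf.1)[w [x fx [->|wx]] <-]; first by rewrite fx rxx; lra.
    have [n [c [Kc cx cw]]] := wx.
    by rewrite -[X in rho X _]fx; exact: aP Kc _ _ cx cw.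
  exists a => -[z z'] [y _ /= [/close yz /close yz']]; apply: rhoU => /=.
  by have := rD z y z'; rewrite (rC z y); lra.
- move=> [z z'] [y _ /= [yz yz']]; exists y => //.
  have mono u : N b y u -> N a y u.
    move=> yu w /yu[x fx [->|[n [c [Kc cx cw]]]]]; exists x => //; first by left.
    by right; exists n, c; split => //;
      [apply: lt_le_trans cx _ | apply: lt_le_trans cw _]; exact: le_dyadic.
  by split; exact: mono.
Qed.

(** If every point of a fibre is isolated then the fibre is open, hence so is
    its image. *)
Lemma image_nonisolated :
  f @` (~` isolated [set: X]) = ~` isolated [set: Y].
Proof.
apply/seteqP; split=> [_ [x nx <-] /isolated_setTP yy|y ny].
  apply: nx; apply/isolated_setTP; have xF := @ctf x _ yy.
  by rewrite -(fiber_interior irf (metrizes_accessible dX) xF).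
apply: contrapT => nox; apply: ny; apply/isolated_setTP.
apply/(nbhs_fiberP cf ctf irf.1) => x fx.
have /isolated_setTP : isolated [set: X] x.
  by apply: contrapT => nx; apply: nox; exists x.
by apply: filterS => _ ->.
Qed.

Lemma sigma'_compact_image : sigma'_compact X -> sigma'_compact Y.
Proof.
move=> [K cK XK]; exists (fun n => f @` K n) => [n|].
  by apply: continuous_compact => //; exact: continuous_subspaceT.
by rewrite -image_nonisolated XK image_bigcup.
Qed.

End Fibers.

(** * Fibres over a Lasnev space *)

Lemma regular_kolmogorov_accessible (Y : topologicalType) :
  regular_space Y -> kolmogorov_space Y -> accessible_space Y.
Proof.
move=> regY T0Y x y /T0Y[A [[]|[]]]; rewrite !inE => nA Ay.
  exists A°; rewrite !inE; split=> // [|/interior_subset//].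
  exact: open_interior.
have [V yV VA] := regY y A nA.
exists (~` closure V); rewrite !inE; split=> [|/VA//|].
  exact/closed_openC/closed_closure.
by apply; apply: subset_closure; exact: nbhs_singleton.
Qed.

Theorem theorem2p1 (R : realType) (X Y : topologicalType) (f : X -> Y)
    (metrizableX : metrizable R X) (lasnevY : lasnev R Y)
    (closedf : closed_map f) (irreduciblef : irreducible_map f)
    (continuousf : continuous f) :
  (* (1) *)
  (forall y : Y, first_countable_at y <-> compact (f @^-1` [set y])) /\
  (* (2) *)
  ((first_countable Y <-> metrizable R Y) /\
   (metrizable R Y <-> forall y : Y, compact (f @^-1` [set y]))) /\
  (* (3) *)
  (forall y : Y,
     ((exists CC : set (set Y),
         [/\ countable_cover CC,
             forall C, CC C -> first_countable_subspace_at C y &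
             inductive_at CC y]) <->
      (locally_compact_subspace (f @^-1` [set y]) /\
       sigma_compact (f @^-1` [set y]))) /\
     ((exists CC : set (set Y),
         [/\ countable_cover CC,
             forall C, CC C -> closed C /\ first_countable_subspace_at C y &
             inductive_at CC y]) <->
      (locally_compact_subspace (f @^-1` [set y]) /\
       sigma_compact (f @^-1` [set y])))) /\
  (* (4) *)
  (((exists CC : set (set Y),
       [/\ countable_cover CC,
           forall C : set Y, CC C -> closed C /\ first_countable C &
           inductive_topology CC]) <->
    (exists Xn : nat -> set X,
       [/\ forall n, closed (Xn n),
           forall m n, (m <= n)%N -> Xn m `<=` Xn n,
           [set: X] = \bigcup_n (Xn n)° &
           forall n y, compact (Xn n `&` f @^-1` [set y])])) /\
   ((exists CC : set (set Y),
       [/\ countable_cover CC,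
           forall C : set Y, CC C -> closed C /\ metrizable R C &
           inductive_topology CC]) <->
    (exists Xn : nat -> set X,
       [/\ forall n, closed (Xn n),
           forall m n, (m <= n)%N -> Xn m `<=` Xn n,
           [set: X] = \bigcup_n (Xn n)° &
           forall n y, compact (Xn n `&` f @^-1` [set y])]))) /\
  (* (5) *)
  (forall y : Y,
     omega_omega_base (nbhs y) <-> sigma_compact (f @^-1` [set y])) /\
  (* (6) *)
  ((universally_omega_omega_based R Y <-> sigma'_compact X) /\
   (sigma'_compact X -> sigma'_compact Y)).
Proof.
have [d dX nX] := metrizableX; have {nX}dX : metrizes d by [].
have T1Y : accessible_space Y.
  by have [regY T0Y _] := lasnevY; exact: regular_kolmogorov_accessible.
have fcP y := first_countable_fiberP dX closedf continuousf irreduciblef T1Y y.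
have sf := irreduciblef.1.
have kM : (forall y, compact (f @^-1` [set y])) -> metrizable R Y.
  exact: (perfect_image_metrizable dX closedf continuousf sf T1Y).
have Mf : metrizable R Y -> first_countable Y.
  exact: metrizable_first_countable.
have fk : first_countable Y -> forall y, compact (f @^-1` [set y]).
  by move=> fcY y; apply/fcP.
split; first exact: fcP.
split; first by split; [split=> [/fk/kM|/Mf] | split=> [/Mf/fk|/kM]].
split; first exact: (inductive_at_fiberP dX closedf continuousf irreduciblef T1Y).
have fcX := inductive_topology_exhaustion dX closedf continuousf irreduciblef T1Y.
have Xm := exhaustion_inductive_topology dX closedf continuousf irreduciblef T1Y.
split; first (split; split).
- by move=> [CC [cCC fcC ind]]; exact: fcX fcC ind.
- move=> [Xn [cX _ XE kX]]; have [CC [cCC mC ind]] := Xm _ cX XE kX.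
  by exists CC; split => // C /mC[cC /metrizable_first_countable].
- move=> [CC [cCC mC ind]]; apply: fcX cCC _ ind => C /mC[cC].
  by move=> /metrizable_first_countable.
- by move=> [Xn [cX _ XE kX]]; exact: Xm _ cX XE kX.
split; first exact: (omega_base_fiberP dX closedf continuousf irreduciblef T1Y).
split; first split.
- exact: (universal_omega_sigma'_compact dX closedf continuousf irreduciblef).
- exact: (sigma'_compact_universal_omega dX closedf continuousf irreduciblef).
- exact: (sigma'_compact_image dX closedf continuousf irreduciblef).
Qed.
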